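(* Let $n\ge1$, $\mu,\lambda^*\in\mathbb{R}$, and $\nu\in\mathbb{R}^n\setminus\{0\}$. Then for $\delta>0$, $\beta<n+2$, the tensor multipliers $M^{\delta,\beta}(\nu)$ and $M^{\mathcal N}(\nu)$ have the same eigenvectors: $\nu$, together with $n-1$ eigenvectors orthogonal to $\nu$ (i.e. for both matrices $\nu$ is an eigenvector, and every nonzero vector orthogonal to $\nu$ is an eigenvector, with one common eigenvalue on the orthogonal complement of $\nu$). Moreover, the eigenvalues $\lambda_1(\nu)$ (associated with $\nu$) and $\lambda_2(\nu)$ (associated with directions orthogonal to $\nu$) of $M^{\delta,\beta}(\nu)$ converge to the corresponding eigenvalues of $M^{\mathcal N}(\nu)$ in the local limits: for every $\beta\le n+2$, $$\lim_{\delta\to0^+}\lambda_1(\nu)=-(\lambda^*+2\mu)\|\nu\|^2,\qquad \lim_{\delta\to0^+}\lambda_2(\nu)=-\mu\|\nu\|^2,$$ and for every $\delta>0$, $$\lim_{\beta\to (n+2)^-}\lambda_1(\nu)=-(\lambda^*+2\mu)\|\nu\|^2,\qquad \lim_{\beta\to (n+2)^-}\lambda_2(\nu)=-\mu\|\nu\|^2.$$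
   Context: $B_\delta(0)$ is the ball of radius $\delta$ centered at $0$ in $\mathbb{R}^n$; $v\otimes w$ is the matrix with entries $v_iw_j$; $I$ is the $n\times n$ identity matrix. For $\delta>0$, $\beta<n+2$, with $$c^{\delta,\beta}=\left(\frac{1}{2n}\int_{B_\delta(0)}\frac{\|w\|^2}{\|w\|^\beta}\,dw\right)^{-1}=\frac{2(n+2-\beta)\Gamma\left(\frac n2+1\right)}{\pi^{n/2}\delta^{n+2-\beta}},$$ the multiplier of the linear peridynamic operator is $M^{\delta,\beta}(\nu)=M_b(\nu)+M_s(\nu)$, where $$M_b(\nu)=(n+2)\,\mu\,c^{\delta,\beta}\int_{B_\delta(0)}\frac{w\otimes w}{\|w\|^{\beta+2}}\big(\cos(\nu\cdot w)-1\big)\,dw,$$ $$M_s(\nu)=-(\lambda^*-\mu)\frac{(c^{\delta,\beta})^2}{4}\left(\int_{B_\delta(0)}\frac{w}{\|w\|^\beta}\sin(\nu\cdot w)\,dw\right)\otimes\left(\int_{B_\delta(0)}\frac{w}{\|w\|^\beta}\sin(\nu\cdot w)\,dw\right).$$ The multiplier of the Navier operator $\mathcal N\mathbf u=(\lambda^*+\mu)\nabla(\nabla\cdot\mathbf u)+\mu\Delta\mathbf u$ is $M^{\mathcal N}(\nu)=-(\lambda^*+\mu)\,\nu\otimes\nu-\mu\|\nu\|^2I$. The eigenvalues of $M^{\delta,\beta}(\nu)$ are given by the following formulas, which also define $\lambda_1,\lambda_2$ when $\beta=n+2$: $$\lambda_1(\nu)=-\|\nu\|^2\Bigg(3\mu\;{}_3F_4\left(1,\tfrac52,\tfrac{n+2-\beta}{2};2,\tfrac32,\tfrac{n+4}{2},\tfrac{n+4-\beta}{2};-\tfrac14\|\nu\|^2\delta^2\right)+(\lambda^*-\mu)\;{}_1F_2\left(\tfrac{n+2-\beta}{2};\tfrac{n+2}{2},\tfrac{n+4-\beta}{2};-\tfrac14\|\nu\|^2\delta^2\right)^2\Bigg),$$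 $$\lambda_2(\nu)=-\mu\|\nu\|^2\;{}_2F_3\left(1,\tfrac{n+2-\beta}{2};2,\tfrac{n+4}{2},\tfrac{n+4-\beta}{2};-\tfrac14\|\nu\|^2\delta^2\right),$$ where ${}_pF_q(a_1,\dots,a_p;b_1,\dots,b_q;z)=\sum_{k\ge0}\frac{(a_1)_k\cdots(a_p)_k}{(b_1)_k\cdots(b_q)_k}\frac{z^k}{k!}$ and $(a)_k=a(a+1)\cdots(a+k-1)$. *)

(* Defs.v *)
From HB Require Import structures.
From mathcomp Require Import all_boot all_order all_algebra.
From mathcomp Require Import all_classical all_reals all_analysis.

Set Implicit Arguments.
Unset Strict Implicit.
Unset Printing Implicit Defensive.

Import Order.TTheory GRing.Theory Num.Theory.
Import numFieldNormedType.Exports.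

Local Open Scope classical_set_scope.
Local Open Scope ring_scope.

(* Lebesgue measure on R^n.  The library has no sigma-algebra on matrices, so
   the measure lives on [n.-tuple R] with its canonical product sigma-algebra;
   it is obtained from the binary product by recursion on n, transported along
   (x, t) |-> x :: t.  [lebesgue_tuple_box] gives its value on boxes. *)
Section lebesgue_tuple.
Variable R : realType.
Local Notation mR := (measurableTypeR R).

Definition tcons n (p : mR * n.-tuple mR) : n.+1.-tuple mR :=
  [tuple of p.1 :: p.2].

Lemma measurable_tcons n : measurable_fun [set: mR * n.-tuple mR] (@tcons n).
Proof. exact: measurable_cons. Qed.

Lemma measurable_tuple_box n (A : 'I_n -> set mR) :
  (forall i, measurable (A i)) ->
  measurable [set t : n.-tuple mR | forall i, A i (tnth t i)].
Proof.
move=> mA.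
rewrite (_ : mkset _ = \bigcap_(i in [set: 'I_n]) ((@tnth n mR ^~ i) @^-1` A i)).
  apply: fin_bigcap_measurable => // i _.
  by rewrite -[X in measurable X]setTI; exact: measurable_tnth.
by apply/seteqP; split => t /= tA i; [move=> _; exact: tA | exact: tA].
Qed.

Section step.
Variables (n : nat) (m : {sigma_finite_measure set (n.-tuple mR) -> \bar R}).

Definition lebesgue_tupleS : set (n.+1.-tuple mR) -> \bar R :=
  pushforward (@lebesgue_measure R \x m)%E (@tcons n).

Let ltS0 : lebesgue_tupleS set0 = 0%E.
Proof. by rewrite /lebesgue_tupleS /pushforward preimage_set0 measure0. Qed.

Let ltS_ge0 A : (0 <= lebesgue_tupleS A)%E.
Proof. by rewrite /lebesgue_tupleS /pushforward. Qed.

Let ltS_sigma_additive : semi_sigma_additive lebesgue_tupleS.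
Proof.
move=> F mF tF mUF; rewrite /lebesgue_tupleS /pushforward preimage_bigcup.
have mt A : measurable A -> measurable (@tcons n @^-1` A).
  by move=> mA; rewrite -[X in measurable X]setTI; exact: measurable_tcons.
apply: measure_semi_sigma_additive.
- by move=> k; exact: mt.
- apply/trivIsetP => /= i j _ _ ij; rewrite -preimage_setI.
  by move/trivIsetP : tF => /(_ _ _ _ _ ij) ->//; rewrite preimage_set0.
- by rewrite -preimage_bigcup; exact: mt.
Qed.

HB.instance Definition _ := isMeasure.Build _ _ _ lebesgue_tupleS
  ltS0 ltS_ge0 ltS_sigma_additive.

Lemma lebesgue_tupleS_box (A : 'I_n.+1 -> set mR) :
  (forall i, measurable (A i)) ->
  lebesgue_tupleS [set t | forall i, A i (tnth t i)] =
  (lebesgue_measure (A ord0) *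
   m [set t | forall i, A (lift ord0 i) (tnth t i)])%E.
Proof.
move=> mA; rewrite -product_measure1E//; last first.
  exact: (@measurable_tuple_box n (fun i => A (lift ord0 i))).
rewrite /lebesgue_tupleS /pushforward; congr (_ _).
apply/seteqP; split => [[x t]/= tA|[x t]/= [Ax tA] i].
  by split=> [|i]; [have := tA ord0|have := tA (lift ord0 i); rewrite tnthS].
by case: (unliftP ord0 i) => [j|] ->; rewrite ?tnthS//; exact: tA.
Qed.

Let ltS_sigma_finite : sigma_finite setT lebesgue_tupleS.
Proof.
have /sigma_finiteP[F [TF ndF Foo]] := sigma_finiteT (@lebesgue_measure R).
have /sigma_finiteP[G [TG ndG Goo]] := sigma_finiteT m.
pose h (t : n.+1.-tuple mR) : n.-tuple mR := [tuple of behead t].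
pose f (t : n.+1.-tuple mR) : mR := tnth t ord0.
have mf : measurable_fun setT f by exact: measurable_tnth.
have mh : measurable_fun setT h by exact: measurable_behead.
have mFG k : measurable (f @^-1` F k `&` h @^-1` G k).
  apply: measurableI; rewrite -[X in measurable X]setTI.
    by apply: mf => //; exact: (Foo k).1.
  by apply: mh => //; exact: (Goo k).1.
exists (fun k => f @^-1` F k `&` h @^-1` G k).
  apply/seteqP; split => // t _.
  have [i _ Fi] : (\bigcup_i F i) (f t) by rewrite -TF.
  have [j _ Gj] : (\bigcup_j G j) (h t) by rewrite -TG.
  exists (maxn i j) => //; split => /=.
    by move: (f t) Fi; exact/subsetPset/ndF/leq_maxl.
  by move: (h t) Gj; exact/subsetPset/ndG/leq_maxr.
move=> k; split; first exact: mFG.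
have [mFk Fk] := Foo k; have [mGk Gk] := Goo k.
rewrite /lebesgue_tupleS /pushforward.
rewrite (_ : _ @^-1` _ = F k `*` G k) ?product_measure1E//.
  by rewrite lte_mul_pinfty// ge0_fin_numE.
apply/seteqP; split => -[x t]/= [Fx Gt]; split => //.
  by move: Gt; congr (G k _); exact: val_inj.
by rewrite /h (_ : [tuple of _] = t)//; exact: val_inj.
Qed.

HB.instance Definition _ := Measure_isSigmaFinite.Build _ _ _ lebesgue_tupleS
  ltS_sigma_finite.
End step.

Fixpoint lebesgue_tuple n : {sigma_finite_measure set (n.-tuple mR) -> \bar R} :=
  match n with
  | 0 => \d_([tuple] : 0.-tuple mR)
  | n'.+1 => lebesgue_tupleS (lebesgue_tuple n')
  end.

Lemma lebesgue_tuple_box n (A : 'I_n -> set mR) :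
  (forall i, measurable (A i)) ->
  lebesgue_tuple n [set t | forall i, A i (tnth t i)] =
  (\prod_(i < n) lebesgue_measure (A i))%E.
Proof.
elim: n A => [|n IHn] A mA.
  by rewrite big_ord0 /= diracE mem_set// => -[].
by rewrite big_ord_recl /= lebesgue_tupleS_box// (IHn (fun i => A (lift ord0 i))).
Qed.

End lebesgue_tuple.

Section euclidean.
Variables (R : realType) (n : nat).

Definition dotv (v w : 'cV[R]_n) : R := \sum_(i < n) v i 0 * w i 0.

(* The canonical norm [`|v|] on matrices is the sup norm. *)
Definition enorm (v : 'cV[R]_n) : R := Num.sqrt (dotv v v).

Definition outer (v w : 'cV[R]_n) : 'M[R]_n := v *m w^T.

Definition eball (delta : R) : set 'cV[R]_n := [set w | enorm w < delta].

Definition colt (t : n.-tuple (measurableTypeR R)) : 'cV[R]_n :=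
  \col_i tnth t i.

Definition int_ball (delta : R) (f : 'cV[R]_n -> R) : R :=
  \int[@lebesgue_tuple R n]_(t in colt @^-1` eball delta) f (colt t).

(* Right eigenvectors, i.e. columns, whereas the library's [eigenspace] is made
   of row vectors acting on the left of M. *)
Definition eigenpair (M : 'M[R]_n) (a : R) (v : 'cV[R]_n) : Prop :=
  v != 0 /\ M *m v = a *: v.

End euclidean.

Section hypergeometric.
Variable R : realType.

Definition pochhammer (a : R) (k : nat) : R := \prod_(i < k) (a + i%:R).

(* pFq(a; b; z), with p = size a and q = size b; for p <= q and no nonpositive
   integer in b the series converges for every z. *)
Definition hypergeom (a b : seq R) (z : R) : R :=
  limn (series (fun k => (\prod_(x <- a) pochhammer x k) /
                         (\prod_(y <- b) pochhammer y k) *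
                         (z ^+ k / k`!%:R))).

End hypergeometric.

Section peridynamics.
Variables (R : realType) (n : nat) (mu lam : R).
Implicit Types (delta beta : R) (nu : 'cV[R]_n).

(* Powers of the norm with real exponent use [powR]; at w = 0 the integrands
   below take junk values, which is harmless since {0} is null for n >= 1. *)
Definition peri_c delta beta : R :=
  ((2 * n%:R)^-1 *
   int_ball delta (fun w : 'cV[R]_n => enorm w ^+ 2 / enorm w `^ beta))^-1.

Definition peri_Mb delta beta nu : 'M[R]_n :=
  ((n%:R + 2) * mu * peri_c delta beta) *:
  \matrix_(i, j) int_ball delta (fun w =>
    outer w w i j / enorm w `^ (beta + 2) * (cos (dotv nu w) - 1)).

Definition peri_sin delta beta nu : 'cV[R]_n :=
  \col_i int_ball delta (fun w =>
    w i 0 / enorm w `^ beta * sin (dotv nu w)).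

Definition peri_Ms delta beta nu : 'M[R]_n :=
  (- (lam - mu) * (peri_c delta beta ^+ 2 / 4)) *:
  outer (peri_sin delta beta nu) (peri_sin delta beta nu).

Definition peri_M delta beta nu : 'M[R]_n :=
  peri_Mb delta beta nu + peri_Ms delta beta nu.

Definition navier_M nu : 'M[R]_n :=
  - (lam + mu) *: outer nu nu - (mu * enorm nu ^+ 2)%:M.

(* Defined for all beta <= n + 2, including the endpoint, where the numerator
   parameter (n + 2 - beta) / 2 vanishes and every series reduces to 1. *)
Definition peri_lambda1 delta beta nu : R :=
  let z := - (4^-1 * enorm nu ^+ 2 * delta ^+ 2) in
  - enorm nu ^+ 2 *
  (3 * mu *
     hypergeom [:: 1; 5 / 2; (n%:R + 2 - beta) / 2]
               [:: 2; 3 / 2; (n%:R + 4) / 2; (n%:R + 4 - beta) / 2] z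
   + (lam - mu) *
     hypergeom [:: (n%:R + 2 - beta) / 2]
               [:: (n%:R + 2) / 2; (n%:R + 4 - beta) / 2] z ^+ 2).

Definition peri_lambda2 delta beta nu : R :=
  let z := - (4^-1 * enorm nu ^+ 2 * delta ^+ 2) in
  - mu * enorm nu ^+ 2 *
  hypergeom [:: 1; (n%:R + 2 - beta) / 2]
            [:: 2; (n%:R + 4) / 2; (n%:R + 4 - beta) / 2] z.

End peridynamics.

(* Main.v *)
Require Import Defs.
From mathcomp Require Import all_boot all_order all_algebra.
From mathcomp Require Import all_classical all_reals all_analysis.
From mathcomp Require Import measurable_realfun ring lra.
Import Order.TTheory GRing.Theory Num.Theory.
Import numFieldNormedType.Exports.
Local Open Scope classical_set_scope.
Local Open Scope ring_scope.

(* A plane rotation is a product of three shears, so Tonelli and translation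
   invariance on the line make Lebesgue measure on R^n rotation invariant.
   Hence the integral of (nu . w)^(2m) |w|^(2p) over a ball is |nu|^(2m) times
   a constant.  Polarizing this identity, i.e. comparing the coefficients of
   s and s^2 after replacing nu by nu + s v, yields the tensor moments; summing
   over an orthonormal basis yields a recursion in m for the constants, which
   leaves only radial integrals.  These scale like powers of the radius, and
   comparing them on thin shells gives the ratios of their values.  Expanding
   cos and sin and integrating term by term then produces the hypergeometric
   series.  Their coefficients after the first lie in [0, min(1, a)] with
   a = (n + 2 - beta) / 2, hence they are within min(1, a) (e^|z| - 1) of 1,
   and both limits follow. *)

Set Implicit Arguments.
Unset Strict Implicit.
Unset Printing Implicit Defensive.

(** * Lebesgue measure on tuples *)

(** The integrands are singular at the origin: for beta >= n the kernel |w|^(-beta-2) is not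
    integrable even against |w|^2, and only the product of the entries of w (x) w with cos - 1, of
    order four, makes it so for all beta < n + 2. Hence every moment carries a condition n/2 + p + m
    > 0, where p is the exponent of |w|^2 and 2m the order of vanishing of the monomial, and the
    majorant for termwise integration must keep these vanishing factors. The normalization
    c^(delta,beta) is, up to 2n, the reciprocal of a radial integral that is also a factor of the
    cosine and sine integrals. It cancels, so the volume of the ball and the Gamma function never
    enter: what is used of the radial integrals is their positivity and their ratios a / (a + j).
    These equal (a)_j / (a + 1)_j, which is why a and a + 1 are parameters of all three series. *)

Section lebesgue_affine.
Variable R : realType.
Local Notation mR := (measurableTypeR R).
Local Notation leb := (@lebesgue_measure R).

Let measurable_addr (a : R) : measurable_fun [set: mR] (fun x : mR => x + a : mR).
Proof. exact: measurable_funD. Qed.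

Let measurable_mulr (a : R) : measurable_fun [set: mR] (fun x : mR => a * x : mR).
Proof. exact: measurable_funM. Qed.

(** The image of Lebesgue measure under a translation gives half-open intervals their length, and
    these values determine the measure. *)
Lemma ge0_integral_translation (f : R -> \bar R) (a : R) :
  measurable_fun setT f -> (forall x, 0 <= f x)%E ->
  (\int[leb]_x f (x + a : R)%R = \int[leb]_x f x)%E.
Proof.
move=> mf f0.
have -> : (\int[leb]_x f (x + a : R)%R =
    \int[pushforward leb (fun x : mR => (x + a)%R : mR)]_x f x)%E.
  by rewrite ge0_integral_pushforward// preimage_setT.
apply: eq_measure_integral => A mA _.
apply/esym/(@lebesgue_measure_unique R) => // _ [[b c]] _ <-.
rewrite /= [RHS](_ : _ = leb `]b - a, c - a]%classic).
  by rewrite !lebesgue_measure_itv/= !lte_fin ltrD2r -!EFinB; case: ifP => // _; congr EFin; ring.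
congr (leb _); apply/seteqP; split => x /=;
    by rewrite !in_itv/= ltrBlDr lerBrDr.
Qed.

Lemma ge0_integral_scaling (f : R -> \bar R) (a : R) : a != 0 ->
  measurable_fun setT f -> (forall x, 0 <= f x)%E ->
  (\int[leb]_x f x = `|a|%:E * \int[leb]_x f (a * x)%R)%E.
Proof.
move=> a0 mf f0.
have := @ge0_integral_pushforward _ _ _ _ R _ (measurable_mulr a) leb setT f.
rewrite preimage_setT => /(_ measurableT mf) /= <-; last by move=> y _; exact: f0.
pose k : {nonneg R} := NngNum (normr_ge0 a).
set m := pushforward _ _.
have <- := @ge0_integral_mscale _ _ R m setT measurableT k f mf (fun x _ => f0 x).
rewrite {}/m.
apply: eq_measure_integral => A mA _.
apply: (@lebesgue_measure_unique R (mscale k _)) => // _ [[b c]] _ <-.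
have [a_gt0|a_lt0|/eqP] := ltrgt0P a; last by rewrite (negbTE a0).
  rewrite /= [RHS](_ : _ = (a%:E : \bar R) * leb `](b / a)%R, (c / a)%R]%classic)%E.
    rewrite !lebesgue_measure_itv/= !lte_fin ltr_pM2r ?invr_gt0//.
    case: ifP => _; last by rewrite mule0.
    by rewrite -!EFinB -EFinM; congr EFin; field.
  rewrite /mscale/= gtr0_norm//; congr (_ * leb _)%E.
  apply/seteqP; split => x /=;
    by rewrite !in_itv/= ltr_pdivrMr// ler_pdivlMr// ![_ * a]mulrC.
(* For negative a the preimage of a half-open interval is reversed, hence closed on the left. *)
rewrite /= [RHS](_ : _ = ((- a)%:E : \bar R) * leb `[(c / a)%R, (b / a)%R[%classic)%E.
  rewrite !lebesgue_measure_itv/= !lte_fin ltr_nM2r ?invr_lt0//.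
  case: ifP => _; last by rewrite mule0.
  by rewrite -!EFinB -EFinM; congr EFin; field.
rewrite /mscale/= ltr0_norm//; congr (_ * leb _)%E.
apply/seteqP; split => x /=;
    by rewrite !in_itv/= ltr_ndivlMr// ler_ndivrMr// ![_ * a]mulrC andbC.
Qed.

End lebesgue_affine.

(** * Rotation invariance in the plane *)

Section plane_rotation.
Variable R : realType.
Local Notation leb := (@lebesgue_measure R).
Local Open Scope ereal_scope.

(** For fixed y the shear is a translation in x, so Tonelli is used to integrate over x first. *)
Lemma ge0_integral_shear_fst (H : R * R -> \bar R) (a : R) :
  measurable_fun setT H -> (forall z, 0 <= H z) ->
  \int[leb]_x \int[leb]_y H ((x + a * y)%R, y) =
  \int[leb]_x \int[leb]_y H (x, y).
Proof.
move=> mH H0.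
have mH' : measurable_fun setT (fun z : R * R => H ((z.1 + a * z.2)%R, z.2)).
  apply: measurableT_comp => //; apply: measurable_fun_pair => //=.
  by apply: measurable_funD => //; exact: measurable_funM.
apply: etrans (@fubini_tonelli _ _ _ _ R leb leb _ mH' (fun=> H0 _)) _.
apply: etrans _ (esym (@fubini_tonelli _ _ _ _ R leb leb _ mH H0)).
apply: eq_integral => y _.
have mHy : measurable_fun setT (fun x => H (x, y)) by exact: measurableT_comp.
exact: (ge0_integral_translation (a * y)%R mHy (fun=> H0 _)).
Qed.

Lemma ge0_integral_shear_snd (H : R * R -> \bar R) (a : R) :
  measurable_fun setT H -> (forall z, 0 <= H z) ->
  \int[leb]_x \int[leb]_y H (x, (y + a * x)%R) =
  \int[leb]_x \int[leb]_y H (x, y).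
Proof.
move=> mH H0; apply: eq_integral => x _.
by rewrite (ge0_integral_translation (f := fun y => H (x, y)))//; exact: measurableT_comp.
Qed.

(* Away from the half turn, a rotation is a product of three shears. *)
Lemma ge0_integral_rotation (H : R * R -> \bar R) (c s : R) :
  (c ^+ 2 + s ^+ 2 = 1)%R -> (1 + c != 0)%R ->
  measurable_fun setT H -> (forall z, 0 <= H z) ->
  \int[leb]_x \int[leb]_y H ((c * x + s * y)%R, (c * y - s * x)%R) =
  \int[leb]_x \int[leb]_y H (x, y).
Proof.
(* [t] is the tangent of half the angle. The shears are x + t y, then y - s x, then x + t y again;
   [tc] and [ts] are the half-angle identities that recombine them into the rotation. *)
move=> cs c1 mH H0; pose t := (s / (1 + c))%R.
have tc : (t * (1 + c) = s)%R by rewrite /t divfK.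
have ts : (t * s = 1 - c)%R.
  apply: (mulIf c1); rewrite mulrAC tc -expr2.
  by move: cs; nra.
have mH1 : measurable_fun setT (fun z : R * R => H ((z.1 + t * z.2)%R, z.2)).
  apply: measurableT_comp => //; apply: measurable_fun_pair => //=.
  by apply: measurable_funD => //; exact: measurable_funM.
pose H' (z : R * R) := H ((z.1 + t * (z.2 + - s * z.1))%R, (z.2 + - s * z.1)%R).
have mH' : measurable_fun setT H'.
  have m2 : measurable_fun setT (fun z : R * R => z.2 + - s * z.1)%R.
    by apply: measurable_funD => //; exact: measurable_funM.
  apply: measurableT_comp => //; apply: measurable_fun_pair => //=.
  by apply: measurable_funD => //; exact: measurable_funM.
apply: etrans _ (ge0_integral_shear_fst t mH H0).
apply: etrans _ (ge0_integral_shear_snd (- s) mH1 (fun=> H0 _)).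
apply: etrans _ (ge0_integral_shear_fst t mH' (fun=> H0 _)).
apply: eq_integral => x _; apply: eq_integral => y _; rewrite /H'/=; congr H; congr pair.
  transitivity ((1 - t * s) * x + (t * (1 + c) - (t * s - (1 - c)) * t) * y)%R.
    by rewrite ts tc; ring.
  by ring.
transitivity ((1 - t * s) * y - s * x)%R; first by rewrite ts; ring.
by ring.
Qed.

Lemma ge0_integral_plane_isotropy (G : R * R -> \bar R) (a b : R) :
  measurable_fun setT G -> (forall z, 0 <= G z) ->
  \int[leb]_x \int[leb]_y G ((a * x + b * y)%R, (x ^+ 2 + y ^+ 2)%R) =
  \int[leb]_x \int[leb]_y
     G ((Num.sqrt (a ^+ 2 + b ^+ 2) * x)%R, (x ^+ 2 + y ^+ 2)%R).
Proof.
move=> mG G0.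
have mGa r r' : measurable_fun setT
    (fun z : R * R => G ((r * z.1 + r' * z.2)%R, (z.1 ^+ 2 + z.2 ^+ 2)%R)).
  apply: measurableT_comp => //; apply: measurable_fun_pair => /=.
    by apply: measurable_funD => /=; exact: measurable_funM.
  by apply: measurable_funD => /=; exact: measurable_funX.
(* The reflection of x reduces to nonnegative a; then the cosine a / rho is not -1, so the half turn
   is avoided. *)
wlog a0 : a / (0 <= a)%R => [wlog_a|].
  have [/wlog_a//|a_lt0] := leP 0%R a.
  have a_ge0 : (0 <= - a)%R by rewrite oppr_ge0 ltW.
  have := wlog_a (- a)%R a_ge0; rewrite (sqrrN a) => wlog_eq.
  apply: etrans _ wlog_eq.
  have N1 : ((- 1 : R) != 0)%R by rewrite oppr_eq0 oner_eq0.
  have mF := measurable_fun_fubini_tonelli_F (m2 := leb) _ (mGa a b) (fun=> G0 _).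
  rewrite (@ge0_integral_scaling _
    (fun x => \int[leb]_y G ((a * x + b * y)%R, (x ^+ 2 + y ^+ 2)%R)) (-1)%R N1 mF)//; last first.
    by move=> x; apply: integral_ge0 => y _.
  rewrite normrN1 mul1e; apply: eq_integral => x _; apply: eq_integral => y _.
  by rewrite mulN1r sqrrN mulrN mulNr.
set rho := Num.sqrt _.
have rho2 : (rho ^+ 2 = a ^+ 2 + b ^+ 2)%R by rewrite sqr_sqrtr// addr_ge0// sqr_ge0.
have [rho0|rho_neq0] := eqVneq rho 0%R.
  have [-> ->] : a = 0%R /\ b = 0%R.
    move: rho2; rewrite rho0 expr0n => /esym/eqP/=.
    by rewrite paddr_eq0 ?sqr_ge0// !sqrf_eq0 => /andP[/eqP -> /eqP ->].
  rewrite rho0; apply: eq_integral => x _; apply: eq_integral => y _.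
  by rewrite !mul0r addr0.
have rho_gt0 : (0 < rho)%R by rewrite lt_neqAle eq_sym rho_neq0 sqrtr_ge0.
have cs : ((a / rho) ^+ 2 + (b / rho) ^+ 2 = 1)%R.
  by rewrite !expr_div_n -mulrDl -rho2 divff// sqrf_eq0.
have c1 : (1 + a / rho != 0)%R.
  by rewrite gt_eqF// ltr_pwDl// divr_ge0// ltW.
have mH := mGa rho 0%R.
apply: (@etrans _ _ (\int[leb]_x \int[leb]_y
    G ((rho * x + 0 * y)%R, (x ^+ 2 + y ^+ 2)%R))); last first.
  by apply: eq_integral => x _; apply: eq_integral => y _; rewrite mul0r addr0.
apply: etrans _ (ge0_integral_rotation cs c1 mH (fun=> G0 _)).
apply: eq_integral => x _; apply: eq_integral => y _.
rewrite /= mul0r addr0; congr (G (_, _)); first by field.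
transitivity (((a / rho) ^+ 2 + (b / rho) ^+ 2) * (x ^+ 2 + y ^+ 2))%R.
  by rewrite cs mul1r.
by ring.
Qed.

End plane_rotation.

Section tuple_integral.
Variable R : realType.
Local Notation leb := (@lebesgue_measure R).
Local Notation lebn := (@lebesgue_tuple R).
Local Open Scope ereal_scope.

(** Coefficient vectors are functions on ordinals, so that dropping the first coordinate in an
    induction on the dimension is composition with [lift ord0]. *)
Definition tdot n (a : 'I_n -> R) (t : n.-tuple R) : R :=
  (\sum_(i < n) a i * tnth t i)%R.

Definition tsq n (t : n.-tuple R) : R := (\sum_(i < n) tnth t i ^+ 2)%R.

Definition fsq n (a : 'I_n -> R) : R := (\sum_(i < n) a i ^+ 2)%R.

Lemma tsq_ge0 n (t : n.-tuple R) : (0 <= tsq t)%R.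
Proof. by apply: sumr_ge0 => i _; exact: sqr_ge0. Qed.

Lemma fsq_ge0 n (a : 'I_n -> R) : (0 <= fsq a)%R.
Proof. by apply: sumr_ge0 => i _; exact: sqr_ge0. Qed.

Lemma measurable_tdot n (a : 'I_n -> R) :
  measurable_fun [set: n.-tuple (measurableTypeR R)] (tdot a).
Proof.
apply: measurable_sum => i.
by apply: measurable_funM => //; exact: measurable_tnth.
Qed.

Lemma measurable_tsq n :
  measurable_fun [set: n.-tuple (measurableTypeR R)] (@tsq n).
Proof.
apply: measurable_sum => i.
by apply: measurable_funX => //; exact: measurable_tnth.
Qed.

Lemma tdot_tcons n (a : 'I_n.+1 -> R) (x : R) (t : n.-tuple R) :
  tdot a (tcons (x, t)) = (a ord0 * x + tdot (fun i => a (lift ord0 i)) t)%R.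
Proof.
rewrite /tdot big_ord_recl; congr (_ + _)%R.
by apply: eq_bigr => i _; rewrite tnthS.
Qed.

Lemma tsq_tcons n (x : R) (t : n.-tuple R) :
  tsq (tcons (x, t)) = (x ^+ 2 + tsq t)%R.
Proof.
rewrite /tsq big_ord_recl; congr (_ + _)%R.
by apply: eq_bigr => i _; rewrite tnthS.
Qed.

Lemma tsq0 (t : 0.-tuple R) : tsq t = 0%R.
Proof. by rewrite /tsq big_ord0. Qed.

(** By construction the measure in dimension n + 1 is the image of a product measure, so this is a
    change of variables followed by Tonelli. *)
Lemma ge0_integral_tupleS n (f : n.+1.-tuple (measurableTypeR R) -> \bar R) :
  measurable_fun setT f -> (forall t, 0 <= f t) ->
  \int[lebn n.+1]_t f t = \int[leb]_x \int[lebn n]_t f (tcons (x, t)).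
Proof.
move=> mf f0.
have := @ge0_integral_pushforward _ _ _ _ R _ (@measurable_tcons R n)
  (leb \x lebn n) setT f measurableT mf (fun y _ => f0 y).
rewrite preimage_setT => ->.
have mfc : measurable_fun setT (f \o @tcons R n).
  by apply: measurableT_comp => //; exact: measurable_tcons.
by rewrite (@fubini_tonelli1 _ _ _ _ R leb (lebn n) _ mfc (fun=> f0 _)).
Qed.

End tuple_integral.

(** * Isotropy and scaling in dimension n *)

Section isotropy.
Variable R : realType.
Local Notation leb := (@lebesgue_measure R).
Local Notation lebn := (@lebesgue_tuple R).
Local Open Scope ereal_scope.

Lemma measurable_tdot_tsq n (a : 'I_n -> R) (phi : R * R -> \bar R) :
  measurable_fun setT phi ->
  measurable_fun [set: n.-tuple (measurableTypeR R)] (fun t => phi (tdot a t, tsq t)).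
Proof.
move=> mphi; apply: measurableT_comp => //; apply: measurable_fun_pair => /=.
  exact: measurable_tdot.
exact: measurable_tsq.
Qed.

(* By induction on n: the tail of [a] is first turned onto its first axis, then
   the first two coordinates are rotated. *)
Lemma ge0_integral_isotropy n (a : 'I_n.+1 -> R) (phi : R * R -> \bar R) :
  measurable_fun setT phi -> (forall z, 0 <= phi z) ->
  \int[lebn n.+1]_t phi (tdot a t, tsq t) =
  \int[lebn n.+1]_t phi ((Num.sqrt (fsq a) * tnth t ord0)%R, tsq t).
Proof.
have mlin (m : nat) (r : R) (psi : R * R -> \bar R) : measurable_fun setT psi ->
    measurable_fun [set: m.+1.-tuple (measurableTypeR R)]
      (fun t => psi ((r * tnth t ord0)%R, tsq t)).
  move=> mpsi; apply: measurableT_comp => //; apply: measurable_fun_pair => /=.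
    by apply: measurable_funM => //; exact: measurable_tnth.
  exact: measurable_tsq.
elim: n a phi => [|n IHn] a phi mphi phi0.
  rewrite [LHS]ge0_integral_tupleS; [|exact: measurable_tdot_tsq|by []].
  rewrite [RHS]ge0_integral_tupleS; [|exact: mlin|by []].
  rewrite /fsq big_ord1 sqrtr_sqr.
  (* In dimension one the square root is an absolute value, and only a sign has to be removed by a
     reflection. *)
  have [a0|a0] := leP 0%R (a ord0).
    apply: eq_integral => x _; apply: eq_integral => t _.
    by rewrite !tdot_tcons tsq_tcons ger0_norm// /tdot big_ord0 addr0.
  have mF : measurable_fun setT (fun x : R =>
      \int[lebn 0]_t phi (tdot a (tcons (x, t)), tsq (tcons (x, t)))).
    apply: (@measurable_fun_fubini_tonelli_F _ _ _ _ R (lebn 0)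
      (fun z => phi (tdot a (tcons z), tsq (tcons z)))) => //.
    apply: (@measurableT_comp _ _ _ _ _ _ (fun t => phi (tdot a t, tsq t))).
      exact: measurable_tdot_tsq.
    exact: measurable_tcons.
  have N1 : ((-1)%R != 0 :> R)%R by rewrite oppr_eq0 oner_eq0.
  rewrite (ge0_integral_scaling N1 mF); last first.
    by move=> x; apply: integral_ge0 => t _.
  rewrite normrN1 mul1e; apply: eq_integral => x _; apply: eq_integral => t _.
  rewrite !tdot_tcons !tsq_tcons mulN1r sqrrN mulrN ltr0_norm// mulNr.
  by rewrite /tdot big_ord0 addr0.
rewrite [LHS]ge0_integral_tupleS; [|exact: measurable_tdot_tsq|by []].
rewrite [RHS]ge0_integral_tupleS; [|exact: mlin|by []].
pose b i := a (lift ord0 i).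
have mphix (x : R) : measurable_fun setT
    (fun z : R * R => phi ((a ord0 * x + z.1)%R, (x ^+ 2 + z.2)%R)).
  apply: measurableT_comp => //; apply: measurable_fun_pair => /=;
    exact: measurable_funD.
(* [G] integrates out all coordinates but two. What remains depends only on a linear form and a
   squared norm in the plane, as the planar statement requires. *)
pose G (z : R * R) : \bar R := \int[lebn n]_t phi (z.1, (z.2 + tsq t)%R).
have mG : measurable_fun setT G.
  pose h (w : (R * R) * n.-tuple (measurableTypeR R)) := phi (w.1.1, (w.1.2 + tsq w.2)%R).
  suff mh : measurable_fun setT h.
    exact: (measurable_fun_fubini_tonelli_F (m2 := lebn n) h mh (fun=> phi0 _)).
  apply: measurableT_comp => //; apply: measurable_fun_pair => /=.
    exact: measurableT_comp.
  apply: measurable_funD; first exact: measurableT_comp.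
  by apply: measurableT_comp => //; exact: measurable_tsq.
have G0 z : 0 <= G z by apply: integral_ge0 => t _.
have ab : (a ord0 ^+ 2 + Num.sqrt (fsq b) ^+ 2 = fsq a)%R.
  by rewrite (sqr_sqrtr (fsq_ge0 b)) /fsq [in RHS]big_ord_recl.
have HG := ge0_integral_plane_isotropy (a ord0) (Num.sqrt (fsq b)) mG G0.
rewrite ab in HG.
transitivity (\int[leb]_x \int[leb]_y
   G ((a ord0 * x + Num.sqrt (fsq b) * y)%R, (x ^+ 2 + y ^+ 2)%R)).
  apply: eq_integral => x _.
  (* With the first coordinate frozen, the integrand is again a function of a linear form in the
     tail and of the squared norm of the tail. *)
  pose phix (z : R * R) := phi ((a ord0 * x + z.1)%R, (x ^+ 2 + z.2)%R).
  transitivity (\int[lebn n.+1]_t phix (tdot b t, tsq t)).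
    by apply: eq_integral => t _; rewrite tdot_tcons tsq_tcons.
  have mphix' : measurable_fun setT phix by exact: mphix.
  rewrite (IHn b phix mphix' (fun=> phi0 _)).
  rewrite [LHS]ge0_integral_tupleS; [|exact: mlin|by move=> t; exact: phi0].
  apply: eq_integral => y _; apply: eq_integral => t _.
  by rewrite /phix tsq_tcons/= addrA.
rewrite HG; apply: eq_integral => x _.
have mtc : measurable_fun [set: n.+1.-tuple (measurableTypeR R)] (fun t => tcons (x, t)).
  apply: (measurableT_comp (@measurable_tcons R n.+1)).
  by apply: measurable_fun_pair => //; exact: measurable_cst.
pose f (t : n.+1.-tuple R) :=
  phi ((Num.sqrt (fsq a) * tnth (tcons (x, t)) ord0)%R, tsq (tcons (x, t))).
have mf : measurable_fun [set: n.+1.-tuple (measurableTypeR R)] f.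
  exact: (measurableT_comp (mlin n.+1 (Num.sqrt (fsq a)) _ mphi) mtc).
have Hf := ge0_integral_tupleS mf (fun=> phi0 _).
apply: etrans (esym Hf).
apply: eq_integral => y _; apply: eq_integral => t _.
by rewrite /f !tsq_tcons/= addrA.
Qed.

Lemma ge0_integral_radial_scaling n (psi : R -> \bar R) (c : R) : (0 < c)%R ->
  measurable_fun setT psi -> (forall q, 0 <= psi q) ->
  \int[lebn n]_t psi (tsq t) = (c ^+ n)%:E * \int[lebn n]_t psi (c ^+ 2 * tsq t)%R.
Proof.
move=> c0; elim: n psi => [|n IHn] psi mpsi psi0.
  rewrite expr0 mul1e; apply: eq_integral => t _.
  by rewrite tsq0 mulr0.
have mt (m : nat) (f : R -> \bar R) : measurable_fun setT f ->
    measurable_fun [set: m.-tuple (measurableTypeR R)] (fun t => f (tsq t)).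
  by move=> mf; apply: measurableT_comp => //; exact: measurable_tsq.
have mc (f : R -> \bar R) (r s : R) : measurable_fun setT f ->
    measurable_fun setT (fun q => f (r * q + s)%R).
  move=> mf; apply: measurableT_comp => //; apply: measurable_funD => //.
have mtc : measurable_fun [set: n.+1.-tuple (measurableTypeR R)]
    (fun t => psi (c ^+ 2 * tsq t)%R).
  by have := mt n.+1 _ (mc psi (c ^+ 2)%R 0%R mpsi); under eq_fun do rewrite addr0.
rewrite [LHS]ge0_integral_tupleS; [|exact: mt|by []].
rewrite [in RHS]ge0_integral_tupleS; [|exact: mtc|by []].
(* In [F] the tail is already rescaled and the first coordinate is not; rescaling the latter
   supplies the last factor c. *)
pose F (x : R) := \int[lebn n]_t psi (c ^+ 2 * tsq t + x ^+ 2)%R.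
have mF : measurable_fun setT F.
  pose h (w : R * n.-tuple (measurableTypeR R)) := psi (c ^+ 2 * tsq w.2 + w.1 ^+ 2)%R.
  suff mh : measurable_fun setT h.
    exact: (measurable_fun_fubini_tonelli_F (m2 := lebn n) h mh (fun=> psi0 _)).
  apply: measurableT_comp => //; apply: measurable_funD; last first.
    by apply: measurable_funX; exact: measurable_fst.
  apply: measurable_funM; first exact: measurable_cst.
  apply: measurableT_comp; [exact: measurable_tsq|exact: measurable_snd].
have F0 x : 0 <= F x by apply: integral_ge0 => t _.
transitivity (\int[leb]_x ((c ^+ n)%:E * F x)).
  apply: eq_integral => x _.
  pose psix q := psi (1 * q + x ^+ 2)%R.
  transitivity (\int[lebn n]_t psix (tsq t)).
    by apply: eq_integral => t _; rewrite tsq_tcons /psix mul1r addrC.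
  rewrite (IHn psix (mc _ _ _ mpsi) (fun=> psi0 _)).
  by congr (_ * _); apply: eq_integral => t _; rewrite /psix mul1r.
have cn0 : 0 <= (c ^+ n)%:E by rewrite lee_fin exprn_ge0// ltW.
have ZF := ge0_integralZl leb measurableT mF (fun x _ => F0 x) cn0.
apply: (etrans ZF).
rewrite (ge0_integral_scaling (lt0r_neq0 c0) mF F0) gtr0_norm// muleA -EFinM -exprSr.
congr (_ * _); apply: eq_integral => x _; apply: eq_integral => t _.
by rewrite tsq_tcons mulrDr exprMn addrC.
Qed.

End isotropy.

(** * Radial integrals *)

Section radial_integrals.
Variables (R : realType) (n : nat).
Local Notation lebn := (@lebesgue_tuple R n).
Local Notation Tn := (n.-tuple (measurableTypeR R)).

(** [A] is a set of values of the squared norm, so balls, punctured balls and shells are all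
    instances; powers of |t|^2 rather than of |t| avoid square roots. *)
Definition radint (A : set R) (p : R) : \bar R :=
  (\int[lebn]_(t in (@tsq R n) @^-1` A) (tsq t `^ p)%:E)%E.

Lemma measurable_tsq_preimage (A : set R) : measurable A ->
  measurable ((@tsq R n : Tn -> R) @^-1` A).
Proof.
by move=> mA; rewrite -[X in measurable X]setTI; exact: (@measurable_tsq R n).
Qed.

Lemma measurable_tsq_powR (D : set Tn) (p : R) :
  measurable_fun D (fun t : Tn => (tsq t `^ p)%:E).
Proof.
apply: measurable_funTS; apply/measurable_EFinP.
apply: (@measurableT_comp _ _ _ _ _ _ (fun q : R => q `^ p)) => //.
exact: measurable_tsq.
Qed.

Lemma radint_ge0 A p : (0 <= radint A p)%E.
Proof. by apply: integral_ge0 => t _; rewrite lee_fin powR_ge0. Qed.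

(** Substituting sqrt k * t for t produces the Jacobian k^(n/2), and the integrand produces k^p. *)
Lemma radint_scaling (A : set R) (p k : R) : measurable A -> 0 < k ->
  radint A p =
  ((k `^ (n%:R / 2 + p))%:E * radint [set q | A (k * q)%R] p)%E.
Proof.
move=> mA k0; have c0 : 0 < Num.sqrt k by rewrite sqrtr_gt0.
have ck : Num.sqrt k ^+ 2 = k by rewrite sqr_sqrtr// ltW.
pose psi (q : R) : \bar R := ((EFin \o (fun q => q `^ p)) \_ A) q.
have mpsi : measurable_fun setT psi.
  have mp : measurable_fun A (EFin \o (fun q => q `^ p)).
    by apply: measurable_funTS; apply/measurable_EFinP; exact: measurable_powR.
  exact: ((measurable_restrictT _ mA).1 mp).
have psi0 q : (0 <= psi q)%E.
  by rewrite /psi patchE; case: ifP => // _; rewrite lee_fin powR_ge0.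
transitivity (\int[lebn]_t psi (tsq t))%E.
  rewrite /radint integral_mkcond; apply: eq_integral => t _.
  by rewrite /psi !patchE.
rewrite (ge0_integral_radial_scaling n c0 mpsi psi0) ck.
have -> : k `^ (n%:R / 2 + p) = Num.sqrt k ^+ n * k `^ p.
  rewrite powRD ?(gt_eqF k0) ?implybT//; congr (_ * _).
  by rewrite -powR12_sqrt ?ltW// -powR_mulrn ?powR_ge0// -powRrM mulrC.
rewrite EFinM -muleA; congr (_ * _)%E.
rewrite -ge0_integralZl//.
- rewrite [RHS]integral_mkcond; apply: eq_integral => t _.
  rewrite /psi !patchE/= (_ : (t \in _) = (k * tsq t \in A)); last first.
    by apply/idP/idP; rewrite !inE.
  by case: ifP => // _; rewrite powRM ?tsq_ge0 ?ltW// EFinM.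
- apply: measurable_tsq_preimage.
  have mk : measurable_fun setT (fun q : R => k * q) by exact: measurable_funM.
  by rewrite -[X in measurable X]setTI; exact: mk.
- exact: measurable_tsq_powR.
- by move=> t _; rewrite lee_fin powR_ge0.
- by rewrite lee_fin powR_ge0.
Qed.

Lemma radint_split (x y z : itv_bound R) (p : R) : (x <= y)%O -> (y <= z)%O ->
  (radint [set` Interval x z] p =
   radint [set` Interval x y] p + radint [set` Interval y z] p)%E.
Proof.
move=> xy yz; rewrite /radint (itv_bndbnd_setU xy yz) preimage_setU.
rewrite ge0_integral_setU//; try by apply: measurable_tsq_preimage.
- exact: measurable_tsq_powR.
- by move=> t _; rewrite lee_fin powR_ge0.
- apply/disj_setPS => t []/=; rewrite !itv_boundlr => /andP[_ h1] /andP[h2 _].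
  by have := le_trans h1 h2; rewrite bnd_simp ltxx.
Qed.


Lemma le_radint (A : set R) (p q c : R) : measurable A -> 0 <= c ->
  (forall x, A x -> 0 <= x -> x `^ p <= c * x `^ q) ->
  (radint A p <= c%:E * radint A q)%E.
Proof.
move=> mA c0 pq; have mD := measurable_tsq_preimage mA.
rewrite -ge0_integralZl//; [|exact: measurable_tsq_powR|
  by move=> t _; rewrite lee_fin powR_ge0].
apply: ge0_le_integral => //.
- by move=> t _; rewrite lee_fin powR_ge0.
- exact: measurable_tsq_powR.
- apply: measurable_funeM; exact: measurable_tsq_powR.
- by move=> t At; rewrite -EFinM lee_fin pq// tsq_ge0.
Qed.

Lemma radint0E (A : set R) : measurable A ->
  radint A 0 = lebn ((@tsq R n) @^-1` A).
Proof.
move=> mA; rewrite -[RHS]mul1e -integral_cst; last exact: measurable_tsq_preimage.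
by apply: eq_integral => t _; rewrite powRr0.
Qed.

Lemma radint_subset (A B : set R) (p : R) : measurable A -> measurable B ->
  A `<=` B -> (radint A p <= radint B p)%E.
Proof.
move=> mA mB AB; apply: ge0_subset_integral; try exact: measurable_tsq_preimage.
- exact: measurable_tsq_powR.
- by move=> t _; rewrite lee_fin powR_ge0.
- by move=> t; exact: AB.
Qed.

(** The unit ball lies in the cube [-1, 1]^n, whose measure is a product of lengths. *)
Lemma lebesgue_tuple_ball_lty : (lebn ((@tsq R n) @^-1` `]-oo, 1%R[) < +oo)%E.
Proof.
pose B : set Tn := [set t | forall i, `[-1, 1]%classic (tnth t i : R)].
apply: (@le_lt_trans _ _ (lebn B)).
  apply: le_measure; rewrite ?inE; first exact: measurable_tsq_preimage.
    by apply: (measurable_tuple_box (A := fun=> `[-1, 1]%classic)) => i.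
  move=> t /=; rewrite ?in_itv/= => t1 i.
  rewrite /= in_itv/= -ler_norml.
  rewrite -(@expr_le1 _ 2)// real_normK ?num_real//.
  apply/ltW/(le_lt_trans _ t1); rewrite /tsq (bigD1 i)//= lerDl.
  by apply: sumr_ge0 => j _; exact: sqr_ge0.
rewrite /B (lebesgue_tuple_box (A := fun=> `[-1, 1]%classic))//.
under eq_bigr do rewrite lebesgue_measure_itv/= lte_fin gtrN ?ltr01// -EFinB.
by rewrite prodEFin ltry.
Qed.

End radial_integrals.

Section radial_values.
Variables (R : realType) (n : nat).
Local Notation lebn := (@lebesgue_tuple R n).
Local Notation radint := (@radint R n).

Let powR_lty_itv (p : R) : (radint `[4^-1%R, 1%R[ p < +oo)%E.
Proof.
(* For x between 1/4 and 1, x^p <= x^(-|p|) <= 4^|p|, whatever the sign of p. *)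
pose c := (4^-1 `^ `|p|)^-1 : R.
have c0 : 0 <= c by rewrite invr_ge0 powR_ge0.
apply: (@le_lt_trans _ _ (c%:E * radint `[4^-1%R, 1%R[ 0)%E).
  apply: le_radint => // x; rewrite /= in_itv/= => /andP[x4 x1] x0.
  have x_gt0 : 0 < x by apply: lt_le_trans x4; rewrite invr_gt0.
  rewrite powRr0 mulr1 (@le_trans _ _ (x `^ (- `|p|)))//.
    by apply: ger_powR; [rewrite x_gt0 ltW|rewrite lerNl -normrN ler_norm].
  rewrite powRN /c lef_pV2 ?posrE ?powR_gt0// ?invr_gt0//.
  by apply: ge0_ler_powR; rewrite ?nnegrE// ?invr_ge0.
rewrite lte_mul_pinfty//.
  apply: (le_lt_trans _ (lebesgue_tuple_ball_lty R n)).
  rewrite radint0E//; apply: le_measure; rewrite ?inE; try exact: measurable_tsq_preimage.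
  by move=> t /=; rewrite !in_itv/= => /andP[].
Qed.

(* On the dyadic shells the integrals form a geometric progression. *)
Lemma radint01_lty (p : R) : 0 < n%:R / 2 + p -> (radint `]0%R, 1%R[ p < +oo)%E.
Proof.
move=> np; set S1 := radint `[4^-1%R, 1%R[ p.
have S1fin : S1 \is a fin_num by rewrite ge0_fin_numE ?radint_ge0 ?powR_lty_itv.
(* The ratio between consecutive shells; it is below 1 because n/2 + p is positive. *)
pose x : R := 4^-1 `^ (n%:R / 2 + p).
have x0 : 0 <= x by exact: powR_ge0.
have x1 : x < 1.
  have : x < 1 `^ (n%:R / 2 + p) by apply: gt0_ltr_powR; rewrite ?nnegrE//; lra.
  by rewrite powR1.
(* The sum of the geometric series. The induction uses it as the fixed point of K = S1 + x K. *)
pose K := fine S1 / (1 - x).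
have Kx : fine S1 + x * K = K by rewrite /K; field; lra.
have K0 : 0 <= K.
  by apply: divr_ge0; [apply: fine_ge0; exact: radint_ge0|rewrite subr_ge0 ltW].
have e_gt0 N : 0 < 4^-1 ^+ N :> R by rewrite exprn_gt0.
have e_le1 N : 4^-1 ^+ N <= 1 :> R by rewrite exprn_ile1//; lra.
have shell N : (radint `[(4^-1 ^+ N)%R, 1%R[ p <= K%:E)%E.
  elim: N => [|N IHN].
    by rewrite expr0 set_itvco0 /radint preimage_set0 integral_set0 lee_fin.
  rewrite (@radint_split _ _ _ (BLeft 4^-1)) ?bnd_simp; [|by rewrite exprS ler_piMr|lra].
  rewrite addeC -/S1 -(fineK S1fin) -Kx EFinD leeD2l//.
  (* The part below 1/4 of the set for N + 1 is the set for N shrunk by 1/4. *)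
  rewrite (@radint_scaling _ _ _ p 4^-1)// EFinM -/x lee_wpmul2l ?lee_fin//.
  rewrite (_ : [set q | _] = `[(4^-1 ^+ N)%R, 1%R[%classic)//.
  apply/seteqP; split => q /=; rewrite !in_itv/= exprS ler_pM2l// gtr_pMr//.
pose F N : set (n.-tuple (measurableTypeR R)) := (@tsq R n) @^-1` `[4^-1 ^+ N, 1[%classic.
have F_cup : (@tsq R n) @^-1` `]0, 1[ = \bigcup_N F N.
  rewrite -preimage_bigcup; congr (_ @^-1` _).
  apply/seteqP; split => [q|q [N _]] /=; rewrite !in_itv/= => /andP[q0 q1]; last first.
    by rewrite q1 (lt_le_trans _ q0).
  have /cvgr0Pnorm_lt/(_ _ q0)[N _ /(_ N (leqnn N))] : (4^-1 : R) ^+ k @[k --> \oo] --> (0 : R).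
    by apply: cvg_expr; rewrite ger0_norm//; lra.
  by rewrite /= ger0_norm ?ltW// => qN; exists N => //=; rewrite in_itv/= q1 ltW.
have Fcvg : (radint `[(4^-1 ^+ N)%R, 1%R[ p @[N --> \oo] --> radint `]0%R, 1%R[ p)%E.
  rewrite /radint F_cup.
  have ndF : {homo F : i j / (i <= j)%N >-> (i <= j)%O}.
    move=> i j ij; apply/subsetPset => t; rewrite /F/= !in_itv/= => /andP[ti ->].
    by rewrite andbT (le_trans _ ti)// ler_wiXn2l// ?invr_ge0//; lra.
  have mF i : measurable (F i) by exact: measurable_tsq_preimage.
  have f0 i (t : n.-tuple (measurableTypeR R)) : F i t -> (0 <= (tsq t `^ p)%:E)%E.
    by move=> _; rewrite lee_fin powR_ge0.
  have H := ge0_nondecreasing_set_cvg_integral (mu := lebn) ndF mF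
    (fun i => @measurable_tsq_powR R n (F i) p) f0.
  exact: H.
rewrite (@le_lt_trans _ _ K%:E) ?ltry//.
rewrite -(cvg_lim _ Fcvg)//; apply: lime_le; first by apply/cvg_ex; eexists; exact: Fcvg.
by apply: nearW.
Qed.

End radial_values.

(** * Ratios and positivity of the radial integrals *)

Section radial_moments.
Variables (R : realType) (n : nat).
Local Notation lebn := (@lebesgue_tuple R n).
Local Notation radint := (@radint R n).

(** In polar coordinates this is the area of the unit sphere divided by n + 2p, when that number is
    positive. The area is never computed: it cancels against the normalizing constant. *)
Definition radmom (p : R) : R := fine (radint `]0%R, 1%R[ p).

Lemma radint_ball (p k : R) : 0 < n%:R / 2 + p -> 0 < k ->
  radint `]0%R, k[ p = (k `^ (n%:R / 2 + p) * radmom p)%:E.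
Proof.
move=> np k0; rewrite (@radint_scaling _ _ _ p k)// EFinM /radmom fineK; last first.
  by rewrite ge0_fin_numE ?radint_ge0// radint01_lty.
rewrite (_ : [set q | _] = `]0%R, 1%R[%classic)//.
by apply/seteqP; split => q /=; rewrite !in_itv/= gtr_pMr// pmulr_rgt0.
Qed.

(** The shell is a difference of two balls. Its outer squared radius is an exponential so that
    taking powers multiplies h, and dividing by h leads to a derivative at 0. *)
Lemma radint_shell (p h : R) : 0 < n%:R / 2 + p -> 0 < h ->
  radint `[1%R, (expR h)[ p = ((expR (h * (n%:R / 2 + p)) - 1) * radmom p)%:E.
Proof.
move=> np h0; have eh : 1 < expR h by rewrite expR_gt1.
have := radint_ball np (expR_gt0 h).
rewrite (@radint_split _ _ _ (BLeft 1)) ?bnd_simp ?ltW//.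
rewrite (radint_ball np ltr01) powR1 mul1r -expRM.
case: (radint _ p) (radint_ge0 n `[1%R, (expR h)[ p) => [s _|//|//].
by rewrite -EFinD => -[rs]; congr EFin; rewrite mulrBl mul1r -rs; ring.
Qed.

Lemma cvg_expR_slope (a : R) : (expR (h * a) - 1) / h @[h --> 0^'+] --> a.
Proof.
apply: cvg_dnbhs_at_right.
have df : is_derive (0 : R) (1 : R) (fun h => expR (h * a)) a.
  apply: is_derive_eq.
  by rewrite mul0r expR0 mul1r scaler0 add0r /GRing.scale/= mulr1.
have [dd de] := df.
have H : h^-1 *: (expR ((h *: (1 : R) + 0) * a) - expR (0 * a)) @[h --> (0 : R)^'] --> a.
  by rewrite -[X in _ --> X]de; exact: dd.
apply: cvg_trans H; apply: near_eq_cvg; near=> h.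
by rewrite /= mul0r expR0 addr0 /GRing.scale/= mulr1 mulrC.
Unshelve. all: by end_near.
Qed.

(* On the shell 1 <= |t|^2 < e^h the integrands for p and p + m agree up to a
   factor e^(h m); divide by h and let h tend to 0. *)
Lemma radmom_shift (p : R) (m : nat) : 0 < n%:R / 2 + p ->
  (n%:R / 2 + p + m%:R) * radmom (p + m%:R) = (n%:R / 2 + p) * radmom p.
Proof.
move=> np; set a := n%:R / 2 + p.
have am0 : 0 < n%:R / 2 + (p + m%:R) by rewrite addrA ltr_wpDr.
have ineq (h : R) : 0 < h ->
    (expR (h * a) - 1) * radmom p <= (expR (h * (a + m%:R)) - 1) * radmom (p + m%:R)
    <= expR (h * m%:R) * ((expR (h * a) - 1) * radmom p).
  move=> h0; have eh : 1 < expR h by rewrite expR_gt1.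
  have Sp := radint_shell np h0.
  have Sm := radint_shell am0 h0.
  rewrite addrA -/a in Sm; rewrite -/a in Sp.
  apply/andP; split; rewrite -lee_fin.
    rewrite -Sp -Sm -[X in (_ <= X)%E]mul1e; apply: le_radint => // x /=.
    by rewrite in_itv/= => /andP[x1 _] _; rewrite mul1r ler_powR// lerDl.
  rewrite [leRHS]EFinM -Sp -Sm; apply: le_radint => //.
  move=> x /=; rewrite in_itv/= => /andP[x1 xh] x0.
  have xgt0 : 0 < x by exact: lt_le_trans x1.
  rewrite powRD ?(gt_eqF xgt0) ?implybT// mulrC ler_wpM2r ?powR_ge0//.
  by rewrite expRM; apply: ge0_ler_powR; rewrite ?nnegrE ?expR_ge0// ltW.
have cvgE (b r : R) : ((expR (h * b) - 1) / h) * r @[h --> 0^'+] --> b * r.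
  by apply: cvgMl; exact: cvg_expR_slope.
have cvgm : expR (h * m%:R) @[h --> 0^'+] --> (1 : R).
  apply: cvg_at_right_filter.
  have c1 : h * m%:R @[h --> (0 : R)] --> (0 : R).
    rewrite -[X in _ --> X](mul0r (m%:R : R)); apply: cvgMl; exact: cvg_id.
  have c2 : expR x @[x --> (0 : R)] --> (1 : R).
    by rewrite -[X in _ --> X](@expR0 R); exact: continuous_expR.
  exact: (cvg_comp _ _ c1 c2).
apply/eqP; rewrite eq_le; apply/andP; split.
  have c2 : expR (h * m%:R) * ((expR (h * a) - 1) / h * radmom p) @[h --> 0^'+] --> a * radmom p.
    by rewrite -[X in _ --> X]mul1r; exact: cvgM.
  have h1 := ler_cvg_to (cvgE (a + m%:R) (radmom (p + m%:R))) c2.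
apply: h1.
  near=> h; have h0 : 0 < h by [].
  have /andP[_] := ineq h h0; rewrite -(ler_pM2r (_ : 0 < h^-1)) ?invr_gt0//.
  by rewrite -!mulrA ![_ * h^-1]mulrC.
apply: (ler_cvg_to (cvgE a (radmom p)) (cvgE (a + m%:R) (radmom (p + m%:R)))).
near=> h; have h0 : 0 < h by [].
have /andP[+ _] := ineq h h0; rewrite -(ler_pM2r (_ : 0 < h^-1)) ?invr_gt0//.
by rewrite -!mulrA ![_ * h^-1]mulrC.
Unshelve. all: by end_near.
Qed.

(** The punctured ball contains a cube of positive measure that stays away from the origin, and
    |t|^(2p) is bounded below there. *)
Lemma radmom_gt0 (p : R) : (0 < n)%N -> 0 < n%:R / 2 + p -> 0 < radmom p.
Proof.
move=> n0 np.
have n1_gt0 : 0 < n%:R + 1 :> R by rewrite ltr_wpDl.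
(* The cube is ]l, u[^n: n u^2 < 1 keeps it inside the unit ball, and one coordinate above l already
   keeps |t|^2 above l^2. *)
pose u : R := (n%:R + 1)^-1; pose l : R := u / 2.
have u0 : 0 < u by rewrite invr_gt0.
have nu : n%:R * u ^+ 2 < 1.
  rewrite expr2 mulrA (@le_lt_trans _ _ (n%:R * u))//.
    by rewrite ler_piMr ?mulr_ge0 ?(ltW u0)// /u invf_le1// lerDr.
  by rewrite ltr_pdivrMr// mul1r ltrDl.
have l0 : 0 < l by rewrite divr_gt0.
have lu : l < u by rewrite /l; lra.
have mB : measurable `]l, u[%classic by exact: measurable_itv.
pose B : set (n.-tuple (measurableTypeR R)) := [set t | forall i, `]l, u[%classic (tnth t i : R)].
have measB : (0 < lebn B)%E.
  rewrite (lebesgue_tuple_box (A := fun=> `]l, u[%classic))//.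
  under eq_bigr do rewrite lebesgue_measure_itv/= lte_fin lu -EFinB.
  by rewrite prodEFin lte_fin prodr_gt0// => i _; rewrite subr_gt0.
have BS : B `<=` (@tsq R n) @^-1` `[(l ^+ 2)%R, 1%R[.
  move=> t Bt; have ti i : l < tnth t i < u by have := Bt i; rewrite /= in_itv.
  rewrite /= in_itv/=; apply/andP; split.
    rewrite /tsq (bigD1 (Ordinal n0))//= -[leLHS]addr0; apply: lerD; last first.
      by apply: sumr_ge0 => j _; exact: sqr_ge0.
    by have /andP[? _] := ti (Ordinal n0); rewrite ler_sqr ?nnegrE; lra.
  apply: le_lt_trans nu; rewrite mulr_natl -[n in leRHS]card_ord -sumr_const.
  apply: ler_sum => i _; have /andP[? ?] := ti i; rewrite ler_sqr ?nnegrE; lra.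
pose c := ((l ^+ 2) `^ `|p|)^-1 : R.
have c0 : 0 <= c by rewrite invr_ge0 powR_ge0.
have l20 : 0 < l ^+ 2 by rewrite exprn_gt0.
have : (0 < c%:E * radint `]0%R, 1%R[ p)%E.
  apply: (lt_le_trans measB); apply: (@le_trans _ _ (radint `[(l ^+ 2)%R, 1%R[ 0)%E).
    rewrite radint0E//; apply: le_measure; rewrite ?inE//.
      exact: (measurable_tuple_box (A := fun=> `]l, u[%classic)).
    exact: measurable_tsq_preimage.
  apply: (@le_trans _ _ (c%:E * radint `[(l ^+ 2)%R, 1%R[ p)%E).
    apply: le_radint => // x; rewrite /= in_itv/= => /andP[lx x1] x0.
    have x_gt0 : 0 < x by exact: lt_le_trans lx.
    rewrite powRr0 mulrC ler_pdivlMr ?powR_gt0// mul1r (@le_trans _ _ (x `^ `|p|))//.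
      by apply: ge0_ler_powR; rewrite ?nnegrE// ltW.
    by apply: ger_powR; [rewrite x_gt0 ltW|exact: ler_norm].
  rewrite lee_wpmul2l ?lee_fin//; apply: radint_subset => //.
  by apply: subset_itvr; rewrite ?bnd_simp.
rewrite (radint_ball np ltr01) powR1 mul1r -EFinM lte_fin.
by rewrite pmulr_rgt0// invr_gt0 powR_gt0.
Qed.

End radial_moments.

(** * Moments of the ball *)

Section ball_moments.
Variables (R : realType) (n : nat) (k : R).
Hypothesis k_gt0 : 0 < k.
Local Notation lebn := (@lebesgue_tuple R n).
Local Notation Tn := (n.-tuple (measurableTypeR R)).
Implicit Types (a u v : 'I_n -> R).

(* The ball of radius sqrt k without its center, where powers of [tsq t] take
   junk values. *)
Definition pball : set Tn := (@tsq R n) @^-1` `]0, k[.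

Lemma measurable_pball : measurable pball.
Proof. exact: measurable_tsq_preimage. Qed.

Lemma pball_gt0 t : pball t -> 0 < tsq t.
Proof. by rewrite /pball/= in_itv/= => /andP[]. Qed.

Lemma pball_lt t : pball t -> tsq t < k.
Proof. by rewrite /pball/= in_itv/= => /andP[]. Qed.

Lemma integrable_pball_powR (e : R) : 0 < n%:R / 2 + e ->
  lebn.-integrable pball (fun t => (tsq t `^ e)%:E).
Proof.
move=> ne; apply/integrableP; split; first exact: measurable_tsq_powR.
apply: (@le_lt_trans _ _ (radint n `]0%R, k[ e)); last first.
  by rewrite (radint_ball ne k_gt0) ltry.
rewrite le_eqVlt; apply/orP; left; apply/eqP; apply: eq_integral => t _.
by rewrite gee0_abs// lee_fin powR_ge0.
Qed.

Lemma integrable_pball_dom (g : Tn -> R) (C e : R) : 0 < n%:R / 2 + e ->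
  measurable_fun setT g ->
  (forall t, pball t -> `|g t| <= C * tsq t `^ e) ->
  lebn.-integrable pball (EFin \o g).
Proof.
move=> ne mg gC; have iC := integrableZl measurable_pball C (integrable_pball_powR ne).
apply: (le_integrable measurable_pball _ _ iC).
  by apply/measurable_EFinP; exact: measurable_funTS.
move=> t Bt /=; rewrite lee_fin; apply: (le_trans (gC t Bt)).
exact: ler_norm.
Qed.

(** Cauchy-Schwarz: by [sumE], |t|^2 times the deficit is a sum of squares. The case t = 0 is
    separate because |t|^2 is cancelled. *)
Lemma tdot_sq_le a (t : Tn) : tdot a t ^+ 2 <= fsq a * tsq t.
Proof.
have sumE : \sum_(i < n) (tsq t * a i - tdot a t * tnth t i) ^+ 2 =
    tsq t * (fsq a * tsq t - tdot a t ^+ 2).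
  transitivity (\sum_(i < n) (tsq t ^+ 2 * a i ^+ 2 -
      2 * tsq t * tdot a t * (a i * tnth t i) + tdot a t ^+ 2 * tnth t i ^+ 2)).
    by apply: eq_bigr => i _; ring.
  rewrite big_split/= sumrB -!mulr_sumr -/(fsq a) -/(tsq t) -/(tdot a t).
  by ring.
have [q0|q0] := eqVneq (tsq t) 0; last first.
  have qgt0 : 0 < tsq t by rewrite lt_neqAle eq_sym q0 tsq_ge0.
  rewrite -subr_ge0 -(pmulr_rge0 _ qgt0) -sumE.
  by apply: sumr_ge0 => i _; exact: sqr_ge0.
rewrite q0 mulr0 (_ : tdot a t = 0) ?expr0n//.
rewrite /tdot big1// => i _; move/eqP: q0; rewrite psumr_eq0; last by move=> j _; exact: sqr_ge0.
by move=> /allP/(_ i (mem_index_enum _))/=; rewrite sqrf_eq0 => /eqP ->; rewrite mulr0.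
Qed.

(** Both sides are squared, so that odd exponents [i] and [j] become powers of x^2 and y^2, each at
    most their sum. *)
Lemma normr_monomial_le (x y : R) (i j m : nat) : (i + j = m.*2)%N ->
  `|x ^+ i * y ^+ j| <= (x ^+ 2 + y ^+ 2) ^+ m.
Proof.
move=> ijm; have xy0 : 0 <= x ^+ 2 + y ^+ 2 by rewrite addr_ge0 ?sqr_ge0.
rewrite -ler_sqr ?nnegrE ?exprn_ge0// real_normK ?num_real//.
rewrite -exprM muln2 -ijm exprD exprMn -!exprM ![(_ * 2)%N]mulnC !exprM.
apply: ler_pM.
- by apply: exprn_ge0; exact: sqr_ge0.
- by apply: exprn_ge0; exact: sqr_ge0.
- by apply: lerXn2r; rewrite ?nnegrE ?sqr_ge0// lerDl sqr_ge0.
- by apply: lerXn2r; rewrite ?nnegrE ?sqr_ge0// lerDr sqr_ge0.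
Qed.

(** The linear forms contribute |t|^(2m) by Cauchy-Schwarz, which compensates a negative p; this is
    what admits every beta below n + 2. *)
Lemma integrable_pball_monomial u v (i j m : nat) (p : R) : (i + j = m.*2)%N ->
  0 < n%:R / 2 + p + m%:R ->
  lebn.-integrable pball
    (fun t => (tdot u t ^+ i * tdot v t ^+ j * tsq t `^ p)%:E).
Proof.
move=> ijm npm.
apply: (@integrable_pball_dom (fun t => tdot u t ^+ i * tdot v t ^+ j * tsq t `^ p)
  ((fsq u + fsq v) ^+ m) (p + m%:R)); first by rewrite addrA.
  apply: measurable_funM; first by apply: measurable_funM; apply: measurable_funX;
    exact: measurable_tdot.
  by apply: (@measurableT_comp _ _ _ _ _ _ (fun q : R => q `^ p)) => //;
    exact: measurable_tsq.
move=> t Bt; have t0 := pball_gt0 Bt.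
rewrite powRD ?(gt_eqF t0) ?implybT// powR_mulrn ?(ltW t0)//.
rewrite normrM [`|tsq t `^ p|]ger0_norm ?powR_ge0//.
rewrite [leRHS]mulrCA [leLHS]mulrC ler_wpM2l ?powR_ge0//.
apply: (le_trans (normr_monomial_le _ _ ijm)).
rewrite -exprMn lerXn2r ?nnegrE ?addr_ge0 ?sqr_ge0 ?mulr_ge0 ?addr_ge0 ?fsq_ge0 ?tsq_ge0//.
by rewrite mulrDl lerD ?tdot_sq_le.
Qed.

End ball_moments.

Section isotropic_moments.
Variables (R : realType) (n' : nat) (k : R).
Local Notation n := n'.+1.
Hypothesis k_gt0 : 0 < k.
Local Notation lebn := (@lebesgue_tuple R n).
Local Notation B := (@pball R n k).

Definition axial_moment (p : R) (m : nat) : R :=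
  \int[lebn]_(t in B) (tnth t ord0 ^+ m.*2 * tsq t `^ p).

(** The even exponent makes the integrand nonnegative, so isotropy applies; the indicator of the
    ball is absorbed into [phi], being a function of |t|^2. *)
Lemma Rintegral_tdot_even (a : 'I_n -> R) (p : R) (m : nat) :
  0 < n%:R / 2 + p + m%:R ->
  \int[lebn]_(t in B) (tdot a t ^+ m.*2 * tsq t `^ p) = fsq a ^+ m * axial_moment p m.
Proof.
move=> npm.
pose phi (z : R * R) : \bar R :=
  if (0 < z.2) && (z.2 < k) then (z.1 ^+ m.*2 * z.2 `^ p)%:E else 0%E.
have mphi : measurable_fun setT phi.
  apply: measurable_fun_ifT => //.
    by apply: measurable_and; apply: measurable_fun_ltr.
  apply/measurable_EFinP; apply: measurable_funM; first exact: measurable_funX.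
  by apply: (@measurableT_comp _ _ _ _ _ _ (fun q : R => q `^ p)).
have phi0 z : (0 <= phi z)%E.
  rewrite /phi; case: ifP => // _; rewrite lee_fin mulr_ge0 ?powR_ge0//.
  by rewrite -muln2 mulnC exprM exprn_ge0// sqr_ge0.
have phiE (f : n.-tuple R -> R) : (\int[lebn]_(t in B) (f t ^+ m.*2 * tsq t `^ p)%:E =
    \int[lebn]_t phi (f t, tsq t))%E.
  rewrite integral_mkcond; apply: eq_integral => t _.
  rewrite patchE /phi/= (_ : (t \in B) = (0 < tsq t) && (tsq t < k))//.
  by apply/idP/idP; rewrite inE /pball/= in_itv.
have E0 (t : n.-tuple R) : tnth t ord0 = tdot (fun i => (i == ord0)%:R) t.
  rewrite /tdot (bigD1 ord0)//= mul1r big1 ?addr0// => i /negbTE ->.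
  by rewrite mul0r.
rewrite /axial_moment -RintegralZl; last 2 first.
- exact: measurable_pball.
- have := @integrable_pball_monomial R n k k_gt0 (fun i => (i == ord0)%:R)
    (fun i => (i == ord0)%:R) m.*2 0 m p (addn0 _) npm.
  by apply: eq_integrable; [exact: measurable_pball|move=> t _/=; rewrite expr0 mulr1 E0].
congr fine; rewrite phiE ge0_integral_isotropy// -(phiE (fun t => Num.sqrt (fsq a) * tnth t ord0)).
apply: eq_integral => t _; rewrite exprMn -{1}muln2 mulnC exprM sqr_sqrtr ?fsq_ge0//.
by rewrite mulrA.
Qed.

End isotropic_moments.

(** * Polynomial identities for the comparison of coefficients *)

Section polynomial_facts.
Variable R : realType.

(** The truncated exponents [m.-1] and [m.-2] are harmless for small m: the factor m or the binomial
    coefficient vanishes whenever truncation occurs. *)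
Lemma coef_quadratic_exp (a b d : R) (m : nat) :
  let p := (a%:P + b *: 'X + d *: 'X^2) ^+ m in
  [/\ p`_0 = a ^+ m, p`_1 = a ^+ m.-1 * b * m%:R &
      p`_2 = a ^+ m.-1 * d * m%:R + a ^+ m.-2 * b ^+ 2 * 'C(m, 2)%:R].
Proof.
set q := _ + _ => /=.
have q0 : q`_0 = a by rewrite /q !coefD !coefZ coefC coefX coefXn/=; ring.
have q1 : q`_1 = b by rewrite /q !coefD !coefZ coefC coefX coefXn/=; ring.
have q2 : q`_2 = d by rewrite /q !coefD !coefZ coefC coefX coefXn/=; ring.
elim: m => [|m [IH0 IH1 IH2]].
  by rewrite expr0 !coef1/= !mulr0 addr0.
rewrite exprSr !coefM !big_ord_recr !big_ord0/= !add0r IH0 IH1 IH2 q0 q1 q2.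
have e1 : a ^+ m.-1 * a * m%:R = a ^+ m * m%:R.
  by case: m {IH0 IH1 IH2} => [|m]; rewrite ?mulr0// -exprSr.
have e2 : a ^+ m.-2 * a * 'C(m, 2)%:R = a ^+ m.-1 * 'C(m, 2)%:R.
  by case: m {IH0 IH1 IH2 e1} => [|[|m]]; rewrite ?mulr0// -exprSr.
rewrite [in 'C(m.+1, 2)]binS bin1 natrD -natr1 /=; split; first by rewrite exprSr.
- move: e1; set N := m%:R; set X := a ^+ m.-1 => e1.
  rewrite (_ : X * b * N * a = X * a * N * b); last by ring.
  by rewrite e1; ring.
- move: e1 e2; set N := m%:R; set X := a ^+ m.-1; set C := _%:R => e1 e2.
  transitivity (a ^+ m * d + X * b * N * b + (X * a * N * d + a ^+ m.-2 * a * C * b ^+ 2)).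
    by ring.
  by rewrite e1 e2; ring.
Qed.

(** A nonzero difference would have more natural numbers as roots than its degree allows. *)
Lemma poly_eq_horner (p q : {poly R}) : (forall x, p.[x] = q.[x]) -> p = q.
Proof.
move=> pq; apply/eqP; rewrite -subr_eq0; apply/eqP/polyP => i.
have [->//|pq0] := eqVneq (p - q) 0; exfalso.
pose rs : seq R := [seq j%:R | j <- iota 0 (size (p - q))].
have urs : uniq rs by rewrite map_inj_uniq ?iota_uniq// => x y /eqP; rewrite eqr_nat => /eqP.
have rrs : all (root (p - q)) rs.
  by apply/allP => x _; rewrite rootE hornerD hornerN pq subrr.
by have := max_poly_roots pq0 rrs urs; rewrite size_map size_iota ltnn.
Qed.

End polynomial_facts.

Section Rintegral_finite_sum.
Context d (T : measurableType d) (R : realType) (mu : {measure set T -> \bar R}).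
Variables (D : set T) (mD : measurable D).

Lemma integrable_bigsum (I : Type) (s : seq I) (f : I -> T -> R) :
  (forall i, mu.-integrable D (EFin \o f i)) ->
  mu.-integrable D (EFin \o (fun t => \sum_(i <- s) f i t)).
Proof.
move=> fi; have := integrable_sum mD s (P := xpredT) (h := fun i => EFin \o f i) (fun i _ => fi i).
by apply: eq_integrable => // t _ /=; rewrite sumEFin.
Qed.

Lemma Rintegral_bigsum (I : Type) (s : seq I) (f : I -> T -> R) :
  (forall i, mu.-integrable D (EFin \o f i)) ->
  \int[mu]_(t in D) (\sum_(i <- s) f i t) = \sum_(i <- s) \int[mu]_(t in D) f i t.
Proof.
move=> fi; elim: s => [|i s IHs].
  by rewrite big_nil; under eq_Rintegral do rewrite big_nil; rewrite Rintegral_cst// mul0r.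
rewrite big_cons -IHs -RintegralD//; last exact: integrable_bigsum.
by apply: eq_Rintegral => t _; rewrite big_cons.
Qed.

End Rintegral_finite_sum.

Section polarization.
Variables (R : realType) (n' : nat) (k : R).
Local Notation n := n'.+1.
Hypothesis k_gt0 : 0 < k.
Local Notation lebn := (@lebesgue_tuple R n).
Local Notation B := (@pball R n k).
Implicit Types (u v : 'I_n -> R) (p : R).

Definition fdot u v : R := \sum_(i < n) u i * v i.

Definition mixed_moment u v (i j : nat) p : R :=
  \int[lebn]_(t in B) (tdot u t ^+ i * tdot v t ^+ j * tsq t `^ p).

(* Both sides are the generating polynomial, in s, of the moments along u + s v. *)
Lemma mixed_moment_poly u v p (m : nat) : 0 < n%:R / 2 + p + m%:R ->
  \poly_(j < m.*2.+1) ('C(m.*2, j)%:R * mixed_moment u v (m.*2 - j) j p) =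
  axial_moment n' k p m *:
    ((fsq u)%:P + (2 * fdot u v) *: 'X + fsq v *: 'X^2) ^+ m.
Proof.
move=> npm; apply: poly_eq_horner => s; rewrite horner_poly.
rewrite hornerZ horner_exp !(hornerD, hornerZ, hornerC, hornerX, hornerXn).
rewrite (_ : _ + _ + _ = fsq (fun i => u i + s * v i)); last first.
  rewrite /fsq /fdot mulr_sumr !mulr_suml -!big_split/=; apply: eq_bigr => i _; ring.
rewrite mulrC -Rintegral_tdot_even//.
have tE (t : n.-tuple R) : tdot (fun i => u i + s * v i) t = tdot u t + s * tdot v t.
  by rewrite /tdot mulr_sumr -big_split/=; apply: eq_bigr => i _; ring.
pose f (j : 'I_m.*2.+1) (t : n.-tuple (measurableTypeR R)) : R :=
  ('C(m.*2, j)%:R * s ^+ j) * (tdot u t ^+ (m.*2 - j) * tdot v t ^+ j * tsq t `^ p).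
have ij (j : 'I_m.*2.+1) : (m.*2 - j + j = m.*2)%N by rewrite subnK// -ltnS.
have fi j := integrable_pball_monomial k_gt0 u v (ij j) npm.
have fi' j : lebn.-integrable B (EFin \o f j).
  have := integrableZl (measurable_pball k) ('C(m.*2, j)%:R * s ^+ j) (fi j).
  by apply: eq_integrable; [exact: measurable_pball|move=> t _ /=; rewrite /f EFinM].
transitivity (\int[lebn]_(t in B) \sum_j f j t).
  rewrite Rintegral_bigsum//; last exact: measurable_pball.
  apply: eq_bigr => j _; rewrite /f RintegralZl//; first by rewrite /mixed_moment; ring.
    exact: measurable_pball.
  exact: fi.
apply: eq_Rintegral => t _; rewrite tE exprDn mulr_suml; apply: eq_bigr => j _.
by rewrite /f exprMn -mulr_natr; ring.
Qed.

(** Coefficients of s: the binomial factor 2m + 2 on one side cancels the factor 2 (m + 1) on the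
    other. *)
Lemma mixed_moment1 u v p (m : nat) : 0 < n%:R / 2 + p + m.+1%:R ->
  mixed_moment u v m.*2.+1 1 p = axial_moment n' k p m.+1 * (fsq u ^+ m * fdot u v).
Proof.
move=> npm; have /(congr1 (fun q : {poly R} => q`_1)) := mixed_moment_poly u v npm.
have [_ e1 _] := coef_quadratic_exp (fsq u) (2 * fdot u v) (fsq v) m.+1.
rewrite coef_poly coefZ e1 doubleS /= bin1 subn1 /= => E.
have m0 : m.*2.+2%:R != 0 :> R by rewrite pnatr_eq0.
apply: (mulfI m0); rewrite E -doubleS -muln2 natrM; ring.
Qed.

(** Coefficients of s^2: the binomial coefficient of 2m + 2 over 2 is (m + 1)(2m + 1), so m + 1
    cancels and 2m + 1 stays on the left. *)
Lemma mixed_moment2 u v p (m : nat) : 0 < n%:R / 2 + p + m.+1%:R ->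
  (m.*2.+1)%:R * mixed_moment u v m.*2 2 p = axial_moment n' k p m.+1 *
    (fsq u ^+ m * fsq v + m.*2%:R * fsq u ^+ m.-1 * fdot u v ^+ 2).
Proof.
move=> npm; have /(congr1 (fun q : {poly R} => q`_2)) := mixed_moment_poly u v npm.
have [_ _ e2] := coef_quadratic_exp (fsq u) (2 * fdot u v) (fsq v) m.+1.
rewrite coef_poly coefZ e2 doubleS /= subSS subn1 /= => E.
have bE (r : nat) : 'C(r.+2, 2)%:R * 2 = r.+2%:R * r.+1%:R :> R.
  by rewrite -natrM (_ : 2%N = 2`!)// bin_ffact !ffactnS ffactn0 muln1 natrM.
have m0 : m.+1%:R != 0 :> R by rewrite pnatr_eq0.
apply: (mulfI m0); apply: (mulIf (_ : (2 : R) != 0)); first by rewrite pnatr_eq0.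
have dbl : m.*2%:R = 2 * m%:R :> R by rewrite -mul2n natrM.
have b1 : 'C(m.*2.+2, 2)%:R = m.+1%:R * m.*2.+1%:R :> R.
  apply: (mulIf (_ : (2 : R) != 0)); first by rewrite pnatr_eq0.
  by rewrite bE -!natr1 dbl; ring.
have b2 : 'C(m.+1, 2)%:R * 2 = m.+1%:R * m%:R :> R.
  by case: m {npm e2 E m0 dbl b1} => [|m]; rewrite ?mulr0 ?bE// mul0r.
rewrite [in LHS]mulrA -b1 E.
transitivity (axial_moment n' k p m.+1 * (2 * fsq u ^+ m * fsq v * m.+1%:R +
  ('C(m.+1, 2)%:R * 2) * fsq u ^+ m.-1 * (4 * fdot u v ^+ 2))); first by ring.
by rewrite b2 dbl; ring.
Qed.

Let e0 (i : 'I_n) : R := (i == ord0)%:R.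

Let tdot_e0 (t : n.-tuple R) : tdot e0 t = tnth t ord0.
Proof.
rewrite /tdot (bigD1 ord0)//= /e0 mul1r big1 ?addr0// => i /negbTE ->.
by rewrite mul0r.
Qed.

(* Summing [mixed_moment2] over an orthonormal basis: |t|^2 is the sum of the
   squares of the coordinates of t. *)
Lemma axial_moment_rec p (m : nat) : 0 < n%:R / 2 + p + m.+1%:R ->
  m.*2.+1%:R * axial_moment n' k (p + 1) m = (n%:R + m.*2%:R) * axial_moment n' k p m.+1.
Proof.
move=> npm; pose e (j i : 'I_n) : R := (i == j)%:R.
have te j (t : n.-tuple R) : tdot (e j) t = tnth t j.
  rewrite /tdot (bigD1 j)//= /e eqxx mul1r big1 ?addr0// => i /negbTE ->.
  by rewrite mul0r.
have fe j : fsq (e j) = 1.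
  rewrite /fsq (bigD1 j)//= /e eqxx expr1n big1 ?addr0// => i /negbTE ->.
  by rewrite expr0n.
have fde j : fdot e0 (e j) = (j == ord0)%:R.
  rewrite /fdot (bigD1 j)//= /e /e0 eqxx mulr1 big1 ?addr0// => i /negbTE ->.
  by rewrite mulr0.
have sumE : axial_moment n' k (p + 1) m = \sum_(j < n) mixed_moment e0 (e j) m.*2 2 p.
  rewrite -Rintegral_bigsum; last 2 first.
  - exact: measurable_pball.
  - have m2 : (m.*2 + 2 = m.+1.*2)%N by rewrite addn2.
  by move=> j; exact: (@integrable_pball_monomial R n k k_gt0 e0 (e j) m.*2 2 m.+1 p m2 npm).
  apply: eq_Rintegral => t /set_mem Bt; have t0 := pball_gt0 Bt.
  rewrite powRD ?(gt_eqF t0) ?implybT// powRr1 ?(ltW t0)//.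
  rewrite -mulr_suml -mulr_sumr tdot_e0 [RHS]mulrAC -mulrA; congr (_ * (_ * _)).
  by apply: eq_bigr => j _; rewrite te.
rewrite sumE mulr_sumr.
under eq_bigr do rewrite mixed_moment2// fe fde -/(e0 _) (_ : fsq e0 = 1) ?fe// !expr1n.
rewrite -mulr_sumr mulrC; congr (_ * _).
rewrite big_split/= sumr_const card_ord mulr1; congr (_ + _).
rewrite (bigD1 ord0)//= expr1n !mulr1 big1 ?addr0// => i.
by rewrite /e0 => /negbTE ->; rewrite expr0n mulr0.
Qed.

(** The recursion trades squares of the coordinate for factors |t|^2 until a radial integral is
    left. The quotient of Pochhammer symbols is the mean of the 2m-th power of a coordinate over the
    unit sphere. *)
Lemma axial_momentE p (m : nat) : 0 < n%:R / 2 + p + m%:R ->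
  axial_moment n' k p m = k `^ (n%:R / 2 + p + m%:R) * radmom n (p + m%:R) *
                 (pochhammer 2^-1 m / pochhammer (n%:R / 2) m).
Proof.
elim: m p => [|m IHm] p npm.
  rewrite addr0 in npm; rewrite /pochhammer !big_ord0 divr1 mulr1 !addr0.
  have := radint_ball npm k_gt0; rewrite /radint => /(congr1 fine)/= <-.
  by congr fine; apply: eq_integral => t _; rewrite expr0 mul1r.
have npm' : 0 < n%:R / 2 + (p + 1) + m%:R by rewrite -natr1 in npm; lra.
have n0 : n%:R / 2 + m%:R != 0 :> R by rewrite gt_eqF// ltr_pwDl// divr_gt0.
have nm0 : n%:R + m.*2%:R != 0 :> R by rewrite gt_eqF// ltr_pwDl// ltr0n.
apply: (mulfI nm0); rewrite -axial_moment_rec// IHm//.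
have poch0 : pochhammer (n%:R / 2) m != 0 :> R.
  by rewrite prodf_seq_neq0; apply/allP => i _ /=; rewrite gt_eqF// ltr_pwDl// divr_gt0.
rewrite /pochhammer !big_ord_recr/= -!/(pochhammer _ _).
have -> : n%:R / 2 + (p + 1) + m%:R = n%:R / 2 + p + m.+1%:R by rewrite -natr1; ring.
have -> : p + 1 + m%:R = p + m.+1%:R by rewrite -natr1; ring.
have dbl : m.*2%:R = 2 * m%:R :> R by rewrite -mul2n natrM.
have n0' : n%:R + 2 * m%:R != 0 :> R by rewrite -dbl.
rewrite -[m.*2.+1%:R]natr1 dbl.
move: n0' poch0; set N : R := n%:R; set P := pochhammer _ m; set Q := pochhammer _ m.
move=> n0' poch0; field.
by rewrite poch0 [_ * 2]mulrC nat1r n0'.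
Qed.

End polarization.

(** * Hypergeometric series *)

Section series_integral.
Context d (T : measurableType d) (R : realType) (mu : {measure set T -> \bar R}).
Variables (D : set T) (mD : measurable D).

(** Dominated convergence for the partial sums, all of which are bounded by the sum of [M] times
    |h|. *)
Lemma cvg_series_Rintegral (f : nat -> T -> R) (F h : T -> R) (M : nat -> R) :
  (forall j, measurable_fun setT (f j)) -> measurable_fun setT F ->
  mu.-integrable D (EFin \o h) ->
  (forall j, 0 <= M j) -> cvgn (series M) ->
  (forall j t, D t -> `|f j t| <= M j * h t) ->
  (forall t, D t -> series (f ^~ t) @ \oo --> F t) ->
  mu.-integrable D (EFin \o F) /\
  (series (fun j => \int[mu]_(t in D) f j t) @ \oo --> \int[mu]_(t in D) F t).
Proof.
move=> mf mF ih M0 cM fM fF.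
pose S := limn (series M).
have MS N : series M N <= S.
  apply: nondecreasing_cvgn_le => //.
  exact: nondecreasing_series.
have mfD j : measurable_fun D (EFin \o f j).
  by apply/measurable_EFinP; exact: measurable_funTS.
have h0 t j : D t -> 0 <= M j * h t by move=> Dt; exact: le_trans (fM j t Dt).
have ifj j : mu.-integrable D (EFin \o f j).
  apply: (le_integrable mD _ _ (integrableZl mD (M j) ih)) => //.
  by move=> t Dt /=; rewrite lee_fin (le_trans (fM j t Dt))// ler_norm.
pose fN N t := \sum_(0 <= j < N) f j t.
have ifN N : mu.-integrable D (EFin \o fN N) by exact: integrable_bigsum.
have ifNE N : (\int[mu]_(t in D) fN N t)%R = series (fun j => \int[mu]_(t in D) f j t) N.
  by rewrite /fN Rintegral_bigsum.
have mfN N : measurable_fun D (EFin \o fN N).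
  by have /integrableP[] := ifN N.
have mFD : measurable_fun D (EFin \o F).
  by apply/measurable_EFinP; exact: measurable_funTS.
pose g t : \bar R := (S%:E * `|(h t)%:E|)%E.
have ig : mu.-integrable D g.
  by apply: (integrableZl mD S); exact: integrable_abse ih.
have cvgF : {ae mu, forall t, D t -> ((EFin \o fN N) t @[N --> \oo] --> (EFin \o F) t)%classic}.
  by apply: aeW => t Dt; apply: cvg_EFin; [exact: nearW|exact: fF].
have domg : {ae mu, forall t, forall N, D t -> (`|(EFin \o fN N) t| <= g t)%E}.
  apply: aeW => t N Dt; rewrite /g /= -EFinM lee_fin.
  apply: (le_trans (ler_norm_sum _ _ _)).
  apply: (@le_trans _ _ (series M N * `|h t|)).
    rewrite mulr_suml; apply: ler_sum => j _; apply: (le_trans (fM j t Dt)).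
    by rewrite ler_wpM2l// ler_norm.
  by rewrite ler_wpM2r.
have [iF _ cF] := dominated_convergence mD mfN mFD cvgF ig domg.
split=> //; rewrite -(eq_cvg _ _ ifNE).
apply: fine_cvg; rewrite fineK; last exact: integrable_fin_num.
exact: cF.
Qed.

End series_integral.

Section hypergeometric_facts.
Variable R : realType.
Implicit Types (a b z : R) (c : nat -> R).

Lemma cvg_series_exp_dom c z m : (forall j, `|c j| <= m) ->
  cvgn (series (fun j => c j * (z ^+ j / j`!%:R))).
Proof.
move=> cm; apply: normed_cvg.
apply: (@series_le_cvg _ _ (m *: exp_coeff `|z|)).
- by move=> j; exact: normr_ge0.
- move=> j /=; rewrite mulr_ge0 ?exp_coeff_ge0// (le_trans _ (cm 0%N))//.
- move=> j /=; rewrite /exp_coeff/= !normrM normrX normfV [`|j`!%:R|]ger0_norm//.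
  by rewrite ler_wpM2r ?cm// divr_ge0 ?exprn_ge0.
- exact/is_cvg_seriesZ/is_cvg_series_exp_coeff.
Qed.

Lemma hypergeom_dist1 c z m : c 0%N = 1 -> (forall j, 0 <= c j.+1 <= m) ->
  `|limn (series (fun j => c j * (z ^+ j / j`!%:R))) - 1| <= m * (expR `|z| - 1).
Proof.
move=> c0 cm.
have cb j : `|c j| <= Num.max 1 m.
  case: j => [|j]; first by rewrite c0 normr1 le_max lexx.
  by have /andP[? ?] := cm j; rewrite ger0_norm// le_max orbC => //; apply/orP; left.
have cv := @cvg_series_exp_dom c z _ cb.
set s := series _ in cv *.
have cvE := is_cvg_series_exp_coeff `|z|.
have sN N : `|s N.+1 - 1| <= m * (series (exp_coeff `|z|) N.+1 - 1).
  rewrite /s /series/= !big_nat_recl//= c0 fact0 expr0 divr1 mulr1.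
  rewrite (_ : exp_coeff `|z| 0%N = 1); last by rewrite /exp_coeff/= expr0 divr1.
  rewrite ![1 + _]addrC !addrK mulr_sumr (le_trans (ler_norm_sum _ _ _))//.
  apply: ler_sum => j _; have /andP[cj0 cjm] := cm j.
  rewrite /exp_coeff/= !normrM normrX normfV [`|_`!%:R|]ger0_norm// ger0_norm//.
  by rewrite ler_wpM2r// divr_ge0 ?exprn_ge0.
have L1 : `|s N.+1 - 1| @[N --> \oo] --> `|limn s - 1|.
  apply: cvg_norm; apply: cvgB; last exact: cvg_cst.
  by rewrite (cvg_shiftS s).
have L2 : m * (series (exp_coeff `|z|) N.+1 - 1) @[N --> \oo] --> m * (expR `|z| - 1).
  apply: cvgMr; apply: cvgB; last exact: cvg_cst.
  by rewrite (cvg_shiftS (series (exp_coeff `|z|))); exact: cvE.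
by apply: (ler_cvg_to L1 L2); exact: nearW.
Qed.

Lemma pochhammerSr a j : pochhammer a j.+1 = pochhammer a j * (a + j%:R).
Proof. by rewrite /pochhammer big_ord_recr. Qed.

Lemma pochhammerSl a j : pochhammer a j.+1 = a * pochhammer (a + 1) j.
Proof.
rewrite /pochhammer big_ord_recl addr0; congr (_ * _); apply: eq_bigr => i _.
by rewrite -addrA [1 + _]addrC natr1.
Qed.

Lemma pochhammer_gt0 a j : 0 < a -> 0 < pochhammer a j.
Proof. by move=> a0; apply: prodr_gt0 => i _; rewrite ltr_pwDl. Qed.

Lemma pochhammer_ge0 a j : 0 <= a -> 0 <= pochhammer a j.
Proof. by move=> a0; apply: prodr_ge0 => i _; rewrite addr_ge0. Qed.

Lemma ler_pochhammer a b j : 0 <= a <= b -> pochhammer a j <= pochhammer b j.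
Proof.
by move=> /andP[a0 ab]; apply: ler_prod => i _; rewrite addr_ge0//= lerD.
Qed.

Lemma pochhammer_1 j : pochhammer 1 j = j`!%:R :> R.
Proof.
elim: j => [|j IHj]; first by rewrite /pochhammer big_ord0.
by rewrite pochhammerSr IHj factS natrM -natr1 mulrC addrC.
Qed.

Lemma pochhammer_ge1 a j : 1 <= a -> 1 <= pochhammer a j.
Proof.
move=> a1; rewrite (@le_trans _ _ (pochhammer 1 j))//; last first.
  by rewrite ler_pochhammer// ler01.
by rewrite pochhammer_1 ler1n fact_gt0.
Qed.

(** The even factors of (2j + 1)! give 2^j j!, the odd ones 2^j (3/2)_j. *)
Lemma fact_odd_pochhammer j : (j.*2.+1)`!%:R = 4 ^+ j * j`!%:R * pochhammer (3 / 2) j :> R.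
Proof.
elim: j => [|j IHj]; first by rewrite /pochhammer big_ord0 expr0 !mulr1.
rewrite doubleS factS natrM factS natrM IHj pochhammerSr factS natrM exprS.
by rewrite -!natr1 -mul2n natrM; field.
Qed.

End hypergeometric_facts.

Section hypergeometric_coefficients.
Variables (R : realType) (n : nat).
Implicit Types (a : R) (j : nat).

(* The coefficients of z^j / j! in the series 1F2, 2F3 and 3F4 of the statement,
   with a = (n + 2 - beta) / 2. *)
Definition hcoef1 a j : R :=
  pochhammer a j / (pochhammer (n%:R / 2 + 1) j * pochhammer (a + 1) j).

Definition hcoef2 a j : R := pochhammer 1 j * pochhammer a j /
  (pochhammer 2 j * (pochhammer (n%:R / 2 + 2) j * pochhammer (a + 1) j)).

Definition hcoef3 a j : R := pochhammer 1 j * (pochhammer (5 / 2) j * pochhammer a j) /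
  (pochhammer 2 j * (pochhammer (3 / 2) j *
    (pochhammer (n%:R / 2 + 2) j * pochhammer (a + 1) j))).

(** The products telescope. The case j = 0 stands apart because at a = 0, that is beta = n + 2, the
    quotient a / (a + 0) evaluates to 0 and not to 1. *)
Lemma pochhammer_ratio a j : 0 <= a ->
  pochhammer a j / pochhammer (a + 1) j = if j is 0 then 1 else a / (a + j%:R).
Proof.
case: j => [|j] a0; first by rewrite /pochhammer !big_ord0 divr1.
have p0 : pochhammer (a + 1) j != 0 by rewrite gt_eqF// pochhammer_gt0// ltr_wpDl.
by rewrite pochhammerSl pochhammerSr invfM mulrA mulfK// -addrA nat1r.
Qed.

Lemma pochhammer_ratio_le a j : 0 <= a ->
  0 <= pochhammer a j.+1 / pochhammer (a + 1) j.+1 <= Num.min 1 a.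
Proof.
move=> a0; rewrite pochhammer_ratio//.
have aj : 0 < a + j.+1%:R by rewrite ltr_wpDl// ltr0n.
rewrite divr_ge0 ?(ltW aj)//= le_min ler_pdivrMr// mul1r lerDl ler0n/=.
by rewrite ler_pdivrMr// ler_peMr// -natr1 addrA lerDr addr_ge0.
Qed.

Let n2 : 1 <= n%:R / 2 + 1 :> R. Proof. by rewrite lerDr divr_ge0. Qed.
Let n4 : 1 <= n%:R / 2 + 2 :> R.
Proof. by rewrite (le_trans n2)// lerD2l ler1n. Qed.

Let damp (x r m : R) : 0 <= x <= 1 -> 0 <= r <= m -> 0 <= x * r <= m.
Proof.
move=> /andP[x0 x1] /andP[r0 rm]; rewrite mulr_ge0//= (le_trans _ rm)//.
by rewrite ler_piMl.
Qed.

Let inv01 (x : R) : 1 <= x -> 0 <= x^-1 <= 1.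
Proof. by move=> x1; rewrite invr_ge0 invf_le1 ?(lt_le_trans ltr01 x1)// (le_trans ler01 x1). Qed.

Let ratio01 (x y : R) : 0 <= x <= y -> 0 < y -> 0 <= x / y <= 1.
Proof. by move=> /andP[x0 xy] y0; rewrite divr_ge0 ?(ltW y0)// ler_pdivrMr// mul1r. Qed.

Lemma hcoef1_le a j : 0 <= a -> 0 <= hcoef1 a j.+1 <= Num.min 1 a.
Proof.
move=> a0; rewrite (_ : hcoef1 a j.+1 = (pochhammer (n%:R / 2 + 1) j.+1)^-1 *
  (pochhammer a j.+1 / pochhammer (a + 1) j.+1)); last by rewrite /hcoef1 invfM mulrCA.
by apply: damp; [apply: inv01; exact: pochhammer_ge1|exact: pochhammer_ratio_le].
Qed.

Lemma hcoef2_le a j : 0 <= a -> 0 <= hcoef2 a j.+1 <= Num.min 1 a.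
Proof.
move=> a0; rewrite (_ : hcoef2 a j.+1 = (pochhammer 1 j.+1 / pochhammer 2 j.+1) *
  ((pochhammer (n%:R / 2 + 2) j.+1)^-1 *
   (pochhammer a j.+1 / pochhammer (a + 1) j.+1))); last by rewrite /hcoef2 !invfM; ring.
apply: damp; last apply: damp.
- apply: ratio01; last exact: pochhammer_gt0.
  by rewrite pochhammer_ge0//= ler_pochhammer// ler01 ler1n.
- by apply: inv01; exact: pochhammer_ge1.
- exact: pochhammer_ratio_le.
Qed.

(** The numerator (5/2)_j is paired with (n/2 + 2)_j, which dominates it because n >= 1. *)
Lemma hcoef3_le a j : (0 < n)%N -> 0 <= a -> 0 <= hcoef3 a j.+1 <= Num.min 1 a.
Proof.
move=> n0 a0; rewrite (_ : hcoef3 a j.+1 = (pochhammer 1 j.+1 / pochhammer 2 j.+1) *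
  ((pochhammer (5 / 2) j.+1 / pochhammer (n%:R / 2 + 2) j.+1) *
  ((pochhammer (3 / 2) j.+1)^-1 *
   (pochhammer a j.+1 / pochhammer (a + 1) j.+1)))); last by rewrite /hcoef3 !invfM; ring.
have n1 : 1 <= n%:R :> R by rewrite ler1n.
apply: damp; last apply: damp; last apply: damp.
- apply: ratio01; last exact: pochhammer_gt0.
  by rewrite pochhammer_ge0//= ler_pochhammer// ler01 ler1n.
- apply: ratio01; last by apply: pochhammer_gt0; lra.
  rewrite pochhammer_ge0/=; last by lra.
  by apply: ler_pochhammer; apply/andP; split; lra.
- by apply: inv01; apply: pochhammer_ge1; lra.
- exact: pochhammer_ratio_le.
Qed.

Lemma hcoef1_0 a : hcoef1 a 0 = 1.
Proof. by rewrite /hcoef1 /pochhammer !big_ord0 mulr1 divr1. Qed.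

Lemma hcoef2_0 a : hcoef2 a 0 = 1.
Proof. by rewrite /hcoef2 /pochhammer !big_ord0 !mulr1 divr1. Qed.

Lemma hcoef3_0 a : hcoef3 a 0 = 1.
Proof. by rewrite /hcoef3 /pochhammer !big_ord0 !mulr1 divr1. Qed.

Definition hypterm (c : nat -> R) (z : R) (j : nat) : R := c j * (z ^+ j / j`!%:R).
Definition hypsum (c : nat -> R) (z : R) : R := limn (series (hypterm c z)).

Lemma hypsum_cvg c z : c 0%N = 1 -> (forall j, 0 <= c j.+1 <= 1) ->
  series (hypterm c z) @ \oo --> hypsum c z.
Proof.
move=> c0 c1; apply: (@cvg_series_exp_dom _ c z 1).
case=> [|j]; first by rewrite c0 normr1.
by have /andP[? ?] := c1 j; rewrite ger0_norm.
Qed.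

End hypergeometric_coefficients.

(** * Integrals of sines and cosines over the ball *)

Section trigonometric_integrals.
Variables (R : realType) (n' : nat) (k : R).
Local Notation n := n'.+1.
Hypothesis k_gt0 : 0 < k.
Local Notation lebn := (@lebesgue_tuple R n).
Local Notation Tn := (n.-tuple (measurableTypeR R)).
Local Notation B := (@pball R n k).
Variable nu : 'I_n -> R.
Implicit Types (u v : 'I_n -> R) (p a : R).
Local Notation z := (- (4^-1 * fsq nu * k)).

Let mtdot (u : 'I_n -> R) : measurable_fun [set: Tn] (tdot u).
Proof. exact: measurable_tdot. Qed.

Let mtsq (p : R) : measurable_fun [set: Tn] (fun t : Tn => tsq t `^ p).
Proof.
apply: (@measurableT_comp _ _ _ _ _ _ (fun q : R => q `^ p)) => //.
exact: measurable_tsq.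
Qed.

Let mtrig (f : R -> R) : continuous f ->
  measurable_fun [set: Tn] (fun t => f (tdot nu t)).
Proof.
by move=> cf; apply: measurableT_comp; [exact: continuous_measurable_fun|exact: mtdot].
Qed.

(** Of the i + j factors |t|^2, the first i are kept, since integrability at the origin needs them;
    the other j are bounded by k and, with 1/r! <= 1/j!, give an exponential series. *)
Let majorant v (t : Tn) (x y r i j : nat) : (x + y = (i + j).*2)%N -> (j <= r)%N -> B t ->
  `|tdot nu t ^+ x * tdot v t ^+ y / r`!%:R| <=
  (fsq nu + fsq v) ^+ i * tsq t ^+ i *
  exp_coeff ((fsq nu + fsq v) * k) j.
Proof.
move=> xy jr Bt; have A0 : 0 <= fsq nu + fsq v by rewrite addr_ge0 ?fsq_ge0.
rewrite normrM normfV [`|r`!%:R|]ger0_norm// /exp_coeff/= mulrA.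
apply: ler_pM; rewrite ?invr_ge0 ?normr_ge0//; last first.
  by rewrite lef_pV2 ?posrE ?ltr0n ?fact_gt0// ler_nat leq_fact.
apply: (le_trans (normr_monomial_le _ _ xy)).
apply: (@le_trans _ _ (((fsq nu + fsq v) * tsq t) ^+ (i + j))).
  apply: lerXn2r; rewrite ?nnegrE ?addr_ge0 ?sqr_ge0// ?mulr_ge0 ?tsq_ge0//.
  by rewrite mulrDl lerD ?tdot_sq_le.
rewrite exprD exprMn ler_wpM2l ?mulr_ge0 ?exprn_ge0 ?tsq_ge0//.
apply: lerXn2r; rewrite ?nnegrE ?mulr_ge0 ?tsq_ge0 ?(ltW k_gt0)//.
by rewrite ler_wpM2l// ltW// pball_lt.
Qed.

(** Common frame of the sine and cosine expansions: [x] and [y] are the exponents of the two linear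
    forms, [s] the signs, [r] the factorial indices, and 2i is the total degree of the first
    term. *)
Let cvg_trig_series v p (i y : nat) (x r : nat -> nat) (s : nat -> R) (G : Tn -> R) :
  0 < n%:R / 2 + (p + i%:R) -> measurable_fun setT G ->
  (forall j, `|s j| = 1) -> (forall j, x j + y = (i + j).*2)%N ->
  (forall j, (j <= r j)%N) ->
  (forall t, B t -> series (fun j => s j *
     (tdot nu t ^+ x j * tdot v t ^+ y / (r j)`!%:R) * tsq t `^ p) @ \oo --> G t) ->
  lebn.-integrable B (EFin \o G) /\
  (series (fun j => s j / (r j)`!%:R * mixed_moment k nu v (x j) y p) @ \oo -->
   \int[lebn]_(t in B) G t).
Proof.
move=> npi mG s1 xy jr fG; have mB := @measurable_pball R n k.
have A0 : 0 <= fsq nu + fsq v by rewrite addr_ge0 ?fsq_ge0.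
pose f j (t : Tn) : R := s j * (tdot nu t ^+ x j * tdot v t ^+ y / (r j)`!%:R) * tsq t `^ p.
pose h (t : Tn) := tsq t `^ (p + i%:R).
pose M j := (fsq nu + fsq v) ^+ i * exp_coeff ((fsq nu + fsq v) * k) j.
have mf j : measurable_fun [set: Tn] (f j).
  apply: measurable_funM => //; apply: measurable_funM => //.
  apply: measurable_funM => //; apply: measurable_funM; exact: measurable_funX.
have ih : lebn.-integrable B (EFin \o h) by exact: (integrable_pball_powR k_gt0).
have M0 j : 0 <= M j.
  by rewrite mulr_ge0 ?exprn_ge0// exp_coeff_ge0// mulr_ge0// ltW.
have cM : cvgn (series M).
  exact/is_cvg_seriesZ/is_cvg_series_exp_coeff.
have fM j t : B t -> `|f j t| <= M j * h t.
  move=> Bt; have t0 := pball_gt0 Bt.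
  rewrite /f /M /h normrM [X in X * _]normrM s1 mul1r [`|tsq t `^ p|]ger0_norm ?powR_ge0//.
  rewrite powRD ?(gt_eqF t0) ?implybT// powR_mulrn ?(ltW t0)//.
  apply: (@le_trans _ _ (((fsq nu + fsq v) ^+ i * tsq t ^+ i *
    exp_coeff ((fsq nu + fsq v) * k) j) * tsq t `^ p)).
    by rewrite ler_wpM2r ?powR_ge0//; apply: majorant.
  by rewrite le_eqVlt; apply/orP; left; apply/eqP; ring.
have [iG cG] := cvg_series_Rintegral mB mf mG ih M0 cM fM fG.
split=> //; rewrite (_ : series _ = series (fun j => \int[lebn]_(t in B) f j t))//.
congr (series _); apply/funext => j; rewrite /mixed_moment -RintegralZl//.
  by apply: eq_Rintegral => t _; rewrite /f; ring.
apply: (integrable_pball_monomial k_gt0 nu v (xy j)).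
by apply: (lt_le_trans npi); rewrite -addrA lerD2l lerD2l ler_nat leq_addr.
Qed.

(** This is where the parameters a and a + 1 of the hypergeometric series originate. *)
Let radmom_pochhammer p j : 0 < n%:R / 2 + p ->
  radmom n (p + j%:R) = pochhammer (n%:R / 2 + p) j / pochhammer (n%:R / 2 + p + 1) j * radmom n p.
Proof.
move=> np; rewrite pochhammer_ratio ?(ltW np)//; case: j => [|j]; first by rewrite addr0 mul1r.
have aj : n%:R / 2 + p + j.+1%:R != 0 by rewrite gt_eqF// ltr_wpDr.
by apply: (mulfI aj); rewrite radmom_shift// mulrA mulrCA divff// mulr1.
Qed.

Let powR_shift a j : k `^ (a + j%:R) = k `^ a * k ^+ j.
Proof. by rewrite powRD ?(gt_eqF k_gt0) ?implybT// powR_mulrn// ltW. Qed.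

Let zX j : z ^+ j = (-1) ^+ j * fsq nu ^+ j * k ^+ j / 4 ^+ j.
Proof. by rewrite [LHS]exprNn !exprMn exprVn; ring. Qed.

Let poch_neq0 a j : 0 < a -> pochhammer a j != 0.
Proof. by move=> a0; rewrite gt_eqF// pochhammer_gt0. Qed.

Let n_neq0 : n%:R != 0 :> R. Proof. by rewrite pnatr_eq0. Qed.

Lemma sine_integral v p : 0 < n%:R / 2 + p + 1 ->
  \int[lebn]_(t in B) (tdot v t * tsq t `^ p * sin (tdot nu t)) =
  fdot nu v * (k `^ (n%:R / 2 + p + 1) * radmom n (p + 1) / n%:R) *
  hypsum (hcoef1 n (n%:R / 2 + p + 1)) z.
Proof.
set a := n%:R / 2 + p + 1 => a0.
have npi : 0 < n%:R / 2 + (p + 1%:R) :> R by rewrite addrA.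
have [||||| _ cF] := @cvg_trig_series v p 1 1 (fun j => j.*2.+1) (fun j => j.*2.+1)
    (fun j => (-1) ^+ j) (fun t => tdot v t * tsq t `^ p * sin (tdot nu t)) npi.
- apply: measurable_funM; first exact: measurable_funM.
  exact: (mtrig (@continuous_sin R)).
-
  by move=> j; rewrite normrX normrN1 expr1n.
- by move=> j; rewrite addn1 add1n doubleS.
- by move=> j; rewrite -addnn -addnS leq_addr.
- move=> t Bt.
  rewrite (_ : series _ = fun N => (tdot v t * tsq t `^ p) * series (sin_coeff' (tdot nu t)) N).
    by apply: cvgMr; exact: cvg_sin_coeff'.
  apply/funext => N; rewrite /series/= mulr_sumr; apply: eq_bigr => j _.
  by rewrite /sin_coeff' exprnP expr1; ring.
have T1 : series (hypterm (hcoef1 n a) z) @ \oo --> hypsum (hcoef1 n a) z.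
  apply: hypsum_cvg; first exact: hcoef1_0.
  move=> j; have /andP[-> /le_trans->//] := hcoef1_le n j (ltW a0).
  by rewrite ge_min lexx.
pose K := fdot nu v * (k `^ a * radmom n (p + 1) / n%:R).
have fE j : (-1) ^+ j / j.*2.+1`!%:R * mixed_moment k nu v j.*2.+1 1 p =
    K * hypterm (hcoef1 n a) z j.
  rewrite mixed_moment1//; last by apply: (lt_le_trans a0); rewrite lerD2l ler1n.
  rewrite axial_momentE//; last by apply: (lt_le_trans a0); rewrite lerD2l ler1n.
  have -> : n%:R / 2 + p + j.+1%:R = a + j%:R by rewrite -nat1r /a; ring.
  have -> : p + j.+1%:R = p + 1 + j%:R by rewrite -nat1r; ring.
  have a0' : 0 < n%:R / 2 + (p + 1) by rewrite addrA.
  rewrite powR_shift radmom_pochhammer// addrA -/a !pochhammerSl.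
  (* The factor (3/2)_j from the spherical mean meets the one in (2j + 1)!; they cancel, which
     leaves a 1F2. *)
  have -> : 2^-1 + 1 = 3 / 2 :> R by field.
  rewrite fact_odd_pochhammer /hypterm /hcoef1 zX /K.
  have P1 : pochhammer (3 / 2) j != 0 :> R by apply: poch_neq0; rewrite divr_gt0.
  have P2 : pochhammer (n%:R / 2 + 1) j != 0 :> R.
    by apply: poch_neq0; rewrite ltr_wpDl// divr_ge0.
  have P3 : pochhammer (a + 1) j != 0 by apply: poch_neq0; rewrite ltr_wpDl// ltW.
  have f0 : j`!%:R != 0 :> R by rewrite pnatr_eq0 -lt0n fact_gt0.
  have p4 : 4 ^+ j != 0 :> R by rewrite expf_neq0.
  move: P1 P2 P3 f0 p4 n_neq0.
  move: (pochhammer _ j) (pochhammer _ j) (pochhammer _ j) (pochhammer _ j) (j`!%:R) (4 ^+ j).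
  move: (n%:R : R) (fsq nu ^+ j) (k ^+ j) ((-1) ^+ j) (k `^ a) (radmom _ _) (fdot _ _).
  move=> N x1 x2 x3 x4 x5 x6 y1 y2 y3 y4 y5 y6 P1 P2 P3 P4 P5 P6.
  field.
  by rewrite P1 P2 P3 P4 P5 P6.
have cK : series (fun j => (-1) ^+ j / j.*2.+1`!%:R * mixed_moment k nu v j.*2.+1 1 p) @ \oo
    --> K * hypsum (hcoef1 n a) z.
  rewrite (_ : series _ = fun N => K * series (hypterm (hcoef1 n a) z) N).
    exact: cvgMr.
  by apply/funext => N; rewrite /series/= mulr_sumr; apply: eq_bigr => j _.
exact: (cvg_unique _ cF cK).
Qed.

Let pochhammers_neq0 a j : 0 < a ->
  [/\ pochhammer 2 j != 0 :> R, pochhammer (n%:R / 2 + 2) j != 0 :> R &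
      pochhammer (a + 1) j != 0].
Proof.
by move=> a0; split; apply: poch_neq0 => //; rewrite ltr_wpDl// ?divr_ge0// ltW.
Qed.

(** The constant of the lowest term: the mean of the fourth power of a coordinate over the unit
    sphere is 3 / (n (n + 2)), and 1/2 is the quadratic coefficient of the cosine. *)
Definition cosint_scale p : R :=
  k `^ (n%:R / 2 + p + 2) * radmom n (p + 2) / (2 * n%:R * (n%:R + 2)).

Local Notation H2 p := (hypsum (hcoef2 n (n%:R / 2 + p + 2)) z).
Local Notation H3 p := (hypsum (hcoef3 n (n%:R / 2 + p + 2)) z).

(** Integrability is part of the conclusion because the bilinear version subtracts two of these
    integrals. *)
Lemma cosine_quadratic_integral v p : 0 < n%:R / 2 + p + 2 ->
  lebn.-integrable B
    (EFin \o (fun t => tdot v t ^+ 2 * tsq t `^ p * (cos (tdot nu t) - 1))) /\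
  \int[lebn]_(t in B) (tdot v t ^+ 2 * tsq t `^ p * (cos (tdot nu t) - 1)) =
  - cosint_scale p *
    (fsq nu * H2 p * fsq v + (3 * H3 p - H2 p) * fdot nu v ^+ 2).
Proof.
set a := n%:R / 2 + p + 2 => a0.
have npi : 0 < n%:R / 2 + (p + 2%:R) :> R by rewrite addrA.
have [||||| iG cF] := @cvg_trig_series v p 2 2 (fun j => j.+1.*2) (fun j => j.+1.*2)
    (fun j => (-1) ^+ j.+1)
    (fun t => tdot v t ^+ 2 * tsq t `^ p * (cos (tdot nu t) - 1)) npi.
- apply: measurable_funM; first by apply: measurable_funM => //; exact: measurable_funX.
  by apply: measurable_funB => //; exact: (mtrig (@continuous_cos R)).
- by move=> j; rewrite normrX normrN1 expr1n.
- by move=> j; rewrite addn2 add2n.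
- by move=> j; rewrite doubleS -addnn -!addnS leq_addr.
- move=> t Bt.
  (* Subtracting 1 removes the constant term of the cosine, whose integral may diverge; hence the
     index shift. *)
  rewrite (_ : series _ = fun N => (tdot v t ^+ 2 * tsq t `^ p) *
      (series (cos_coeff' (tdot nu t)) N.+1 - 1)).
    apply: cvgMr; apply: cvgB; last exact: cvg_cst.
    by rewrite (cvg_shiftS (series (cos_coeff' (tdot nu t)))); exact: cvg_cos_coeff'.
  apply/funext => N; rewrite /series/= big_nat_recl//= (_ : cos_coeff' _ 0%N = 1); last first.
    by rewrite /cos_coeff' expr0z double0 expr0 fact0 mul1r divr1.
  rewrite [1 + _]addrC addrK mulr_sumr; apply: eq_bigr => j _.
  by rewrite /cos_coeff' -exprnP; ring.
split=> //.
have T2 : series (hypterm (hcoef2 n a) z) @ \oo --> hypsum (hcoef2 n a) z.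
  apply: hypsum_cvg; first exact: hcoef2_0.
  move=> j; have /andP[-> /le_trans->//] := hcoef2_le n j (ltW a0).
  by rewrite ge_min lexx.
have T3 : series (hypterm (hcoef3 n a) z) @ \oo --> hypsum (hcoef3 n a) z.
  apply: hypsum_cvg; first exact: hcoef3_0.
  move=> j; have /andP[-> /le_trans->//] := hcoef3_le j (ltn0Sn n') (ltW a0).
  by rewrite ge_min lexx.
(* The weight (2j + 3) / 3 is (5/2)_j / (3/2)_j, the two parameters that distinguish the 3F4 from
   the 2F3. *)
have cE j : hypterm (hcoef3 n a) z j = (j.*2.+1%:R + 2) / 3 * hypterm (hcoef2 n a) z j.
  suff HE : hcoef3 n a j = (j.*2.+1%:R + 2) / 3 * hcoef2 n a j by rewrite /hypterm HE [RHS]mulrA.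
  rewrite /hcoef3 /hcoef2.
  have PE : pochhammer (5 / 2) j = (j.*2.+1%:R + 2) / 3 * pochhammer (3 / 2) j :> R.
    have := pochhammerSl (3 / 2 : R) j; rewrite pochhammerSr.
    have -> : 3 / 2 + 1 = 5 / 2 :> R by field.
    move=> E; apply: (mulfI (_ : (3 / 2 : R) != 0)); first by rewrite gt_eqF ?divr_gt0.
    have -> : j.*2.+1%:R = 2 * j%:R + 1 :> R by rewrite -natr1 -mul2n natrM.
    by rewrite -E; field.
  have P1 : pochhammer (3 / 2) j != 0 :> R by apply: poch_neq0; rewrite divr_gt0.
  have := pochhammers_neq0 j a0; rewrite PE.
  move: P1; move: (pochhammer _ j) (pochhammer _ j) (pochhammer _ j) (pochhammer _ j)
    (pochhammer _ j) (pochhammer _ j) (j.*2.+1%:R).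
  move=> x1 x2 x3 x4 x5 x6 y P1 [P2 P3 P4].
  by field; rewrite P1 P2 P3 P4.
pose K := - cosint_scale p.
(* Writing 2j + 2 as (2j + 3) - 1 in the second mixed moment separates the part of [v] orthogonal to
   [nu], which goes with the 2F3, from the parallel part, which goes with the 3F4. *)
pose c2 := fsq nu * fsq v - fdot nu v ^+ 2.
pose c3 := 3 * fdot nu v ^+ 2.
have fE j : (-1) ^+ j.+1 / j.+1.*2`!%:R * mixed_moment k nu v j.+1.*2 2 p =
    K * (c2 * hypterm (hcoef2 n a) z j + c3 * hypterm (hcoef3 n a) z j).
  have odd_neq0 : j.+1.*2.+1%:R != 0 :> R by rewrite pnatr_eq0.
  have j2E : j.+2%:R = 2 + j%:R :> R by rewrite -natrD.
  have npm : 0 < n%:R / 2 + p + j.+2%:R.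
    by apply: (lt_le_trans a0); rewrite lerD2l ler_nat.
  have -> : mixed_moment k nu v j.+1.*2 2 p =
      (j.+1.*2.+1%:R)^-1 * (j.+1.*2.+1%:R * mixed_moment k nu v j.+1.*2 2 p).
    by rewrite mulKf.
  rewrite mixed_moment2// axial_momentE//= cE.
  have -> : n%:R / 2 + p + j.+2%:R = a + j%:R by rewrite j2E /a; ring.
  have -> : p + j.+2%:R = p + 2 + j%:R by rewrite j2E; ring.
  have a0' : 0 < n%:R / 2 + (p + 2) by rewrite addrA.
  rewrite powR_shift radmom_pochhammer// addrA -/a.
  (* Rewriting (2j + 2)! as (2j + 3)! / (2j + 3) makes the odd factorial formula applicable, and the
     quotient cancels the factor from [mixed_moment2]. *)
  have FE : j.+1.*2`!%:R = 4 ^+ j.+1 * j.+1`!%:R * pochhammer (3 / 2) j.+1 / j.+1.*2.+1%:R :> R.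
    by rewrite -fact_odd_pochhammer factS natrM mulrAC divff// mul1r.
  have j1 : j.+1`!%:R = pochhammer 2 j :> R.
    by rewrite -pochhammer_1 pochhammerSl mul1r.
  rewrite FE j1 !pochhammerSl /hypterm /hcoef2 zX pochhammer_1 /K /cosint_scale -/a.
  have -> : 2^-1 + 1 = 3 / 2 :> R by field.
  have -> : 3 / 2 + 1 = 5 / 2 :> R by field.
  have -> : n%:R / 2 + 1 + 1 = n%:R / 2 + 2 :> R by ring.
  have P4 : pochhammer (5 / 2) j != 0 :> R by apply: poch_neq0; rewrite divr_gt0.
  have P5 : j`!%:R != 0 :> R by rewrite pnatr_eq0 -lt0n fact_gt0.
  have P6 : 4 ^+ j != 0 :> R by rewrite expf_neq0.
  have P7 : n%:R + 2 != 0 :> R by rewrite gt_eqF// addr_gt0.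
  have [P1 P2 P3] := pochhammers_neq0 j a0.
  have jE : j.+1.*2%:R = j.+1.*2.+1%:R - 1 :> R by rewrite -natr1 addrK.
  have jE' : j.*2.+1%:R = j.+1.*2.+1%:R - 2 :> R by rewrite doubleS -!natr1; ring.
  rewrite jE jE' /c2 /c3 !exprS.
  move: n_neq0 odd_neq0 P1 P2 P3 P4 P5 P6 P7.
  move: (pochhammer _ j) (pochhammer _ j) (pochhammer _ j) (pochhammer _ j) (pochhammer _ j).
  move: (j`!%:R) (4 ^+ j) (j.+1.*2.+1%:R).
  move: (n%:R : R) (fsq nu ^+ j) (k ^+ j) ((-1) ^+ j) (k `^ a) (radmom _ _) (fdot _ _).
  move=> N x1 x2 x3 x4 x5 x6 y1 y2 y3 w1 w2 w3 w4 w5 P1 P2 P3 P4 P5 P6 P7 P8 P9.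
  field.
  by rewrite P1 P2 P3 P4 P5 P6 P7 P8 P9.
have cK : series (fun j => (-1) ^+ j.+1 / j.+1.*2`!%:R * mixed_moment k nu v j.+1.*2 2 p) @ \oo
    --> K * (c2 * hypsum (hcoef2 n a) z + c3 * hypsum (hcoef3 n a) z).
  rewrite (_ : series _ = fun N => K * (c2 * series (hypterm (hcoef2 n a) z) N +
      c3 * series (hypterm (hcoef3 n a) z) N)).
    by apply: cvgMr; apply: cvgD; apply: cvgMr.
  apply/funext => N; rewrite /series/= [c2 * _]mulr_sumr [c3 * _]mulr_sumr.
  by rewrite -big_split/= mulr_sumr; apply: eq_bigr => j _; exact: fE.
by rewrite (cvg_unique _ cF cK)// /K /c2 /c3; ring.
Qed.

End trigonometric_integrals.

(** * The multipliers *)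

Section multiplier.
Variables (R : realType) (n' : nat).
Local Notation n := n'.+1.
Local Notation lebn := (@lebesgue_tuple R n).
Implicit Types (delta beta : R) (nu v : 'cV[R]_n).

Definition cvfun (v : 'cV[R]_n) (i : 'I_n) : R := v i 0.

Lemma dotv_colt v (t : n.-tuple R) : dotv v (colt t) = tdot (cvfun v) t.
Proof. by apply: eq_bigr => i _; rewrite mxE. Qed.

Lemma dotv_colt_self (t : n.-tuple R) : dotv (colt t) (colt t) = tsq t.
Proof. by apply: eq_bigr => i _; rewrite mxE expr2. Qed.

Lemma enorm_sq v : enorm v ^+ 2 = fsq (cvfun v).
Proof.
have E : dotv v v = fsq (cvfun v) by apply: eq_bigr => i _; rewrite expr2.
by rewrite /enorm E sqr_sqrtr ?fsq_ge0.
Qed.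

Lemma enorm_powR (t : n.-tuple R) (s : R) : enorm (colt t) `^ s = tsq t `^ (s / 2).
Proof.
by rewrite /enorm dotv_colt_self -powR12_sqrt ?tsq_ge0// -powRrM mulrC.
Qed.

Lemma colt_eq0 (t : n.-tuple R) : tsq t = 0 -> colt t = 0.
Proof.
move=> /eqP; rewrite psumr_eq0; last by move=> j _; exact: sqr_ge0.
move=> /allP t0; apply/matrixP => i j; rewrite !mxE.
by have := t0 i (mem_index_enum _); rewrite /= sqrf_eq0 => /eqP.
Qed.

(** No null set argument is needed for the center: the integrands of the multiplier contain w or
    |w|^2 and vanish there. *)
Lemma int_ballE delta (f : 'cV[R]_n -> R) : 0 < delta -> f 0 = 0 ->
  int_ball delta f = \int[lebn]_(t in pball (delta ^+ 2)) f (colt t).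
Proof.
move=> d0 f0; rewrite /int_ball Rintegral_mkcond [RHS]Rintegral_mkcond.
apply: eq_Rintegral => t _; rewrite !patchE.
have -> : (t \in (@colt R n) @^-1` eball delta) = (tsq t < delta ^+ 2).
  rewrite -(sqr_sqrtr (tsq_ge0 t)) ltr_sqr ?nnegrE ?sqrtr_ge0 ?ltW// -dotv_colt_self.
  by apply/idP/idP; rewrite inE.
have -> : (t \in pball (delta ^+ 2)) = (0 < tsq t) && (tsq t < delta ^+ 2).
  by apply/idP/idP; rewrite inE /pball/= in_itv.
rewrite [X in X && _]lt_neqAle tsq_ge0 andbT eq_sym; case: eqVneq => [/colt_eq0->|_]//=.
by rewrite f0 if_same.
Qed.

Let enorm0 : enorm (0 : 'cV[R]_n) = 0.
Proof. by apply/eqP; rewrite -sqrf_eq0 enorm_sq /fsq big1// => i _; rewrite /cvfun mxE expr0n. Qed.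

Lemma peri_cE delta beta : 0 < delta -> 0 < n%:R / 2 + (1 - beta / 2) ->
  peri_c n delta beta =
  2 * n%:R / ((delta ^+ 2) `^ (n%:R / 2 + (1 - beta / 2)) * radmom n (1 - beta / 2)).
Proof.
move=> d0 nb; rewrite /peri_c int_ballE//; last by rewrite enorm0 expr0n mul0r.
rewrite (_ : \int[_]_(t in _) _ =
  (delta ^+ 2) `^ (n%:R / 2 + (1 - beta / 2)) * radmom n (1 - beta / 2)).
  by rewrite invfM invrK.
have := radint_ball nb (exprn_gt0 2 d0); rewrite /radint => /(congr1 fine)/= <-.
congr fine; apply: eq_integral => t /set_mem Bt; have t0 := pball_gt0 Bt.
rewrite enorm_powR /enorm dotv_colt_self sqr_sqrtr ?tsq_ge0//.
by rewrite -{1}(powRr1 (tsq_ge0 t)) -powRB ?(gt_eqF t0) ?implybT.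
Qed.

Section bilinear.
Variables (k : R) (nu : 'I_n -> R).
Hypothesis k_gt0 : 0 < k.
Local Notation z := (- (4^-1 * fsq nu * k)).

(** Polarization: 4 (u . t)(v . t) is the difference of the squares of (u + v) . t and (u - v) .
    t. *)
Lemma cosine_bilinear_integral (u v : 'I_n -> R) (p : R) :
  let a := n%:R / 2 + p + 2 in 0 < a ->
  \int[lebn]_(t in pball k)
    (tdot u t * tdot v t * tsq t `^ p * (cos (tdot nu t) - 1)) =
  - cosint_scale n' k p *
    (fsq nu * hypsum (hcoef2 n a) z * fdot u v +
     (3 * hypsum (hcoef3 n a) z - hypsum (hcoef2 n a) z) * (fdot nu u * fdot nu v)).
Proof.
move=> a a0.
have [i1 q1] := cosine_quadratic_integral k_gt0 nu (fun i => u i + v i) a0.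
have [i2 q2] := cosine_quadratic_integral k_gt0 nu (fun i => u i - v i) a0.
have tD (t : n.-tuple R) : tdot (fun i => u i + v i) t = tdot u t + tdot v t.
  by rewrite /tdot -big_split; apply: eq_bigr => i _; rewrite mulrDl.
have tB (t : n.-tuple R) : tdot (fun i => u i - v i) t = tdot u t - tdot v t.
  by rewrite /tdot -sumrB; apply: eq_bigr => i _; rewrite mulrBl.
have mB := @measurable_pball R n k.
have i12 := integrableB mB i1 i2.
transitivity (4^-1 * \int[lebn]_(t in pball k)
   (tdot (fun i => u i + v i) t ^+ 2 * tsq t `^ p * (cos (tdot nu t) - 1) -
    tdot (fun i => u i - v i) t ^+ 2 * tsq t `^ p * (cos (tdot nu t) - 1))).
  rewrite -RintegralZl//; apply: eq_Rintegral => t _; rewrite tD tB.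
  by field.
rewrite RintegralB// q1 q2.
have fD : fdot nu (fun i => u i + v i) = fdot nu u + fdot nu v.
  by rewrite /fdot -big_split; apply: eq_bigr => i _; rewrite mulrDr.
have fB : fdot nu (fun i => u i - v i) = fdot nu u - fdot nu v.
  by rewrite /fdot -sumrB; apply: eq_bigr => i _; rewrite mulrBr.
have sD : fsq (fun i => u i + v i) = fsq u + 2 * fdot u v + fsq v.
  rewrite /fsq /fdot mulr_sumr -!big_split; apply: eq_bigr => i _ /=; ring.
have sB : fsq (fun i => u i - v i) = fsq u - 2 * fdot u v + fsq v.
  rewrite /fsq /fdot mulr_sumr -sumrB -big_split; apply: eq_bigr => i _ /=; ring.
by rewrite fD fB sD sB -/a; field.
Qed.

End bilinear.

Definition basisfun (i j : 'I_n) : R := (j == i)%:R.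

Lemma tdot_basis i (t : n.-tuple R) : tdot (basisfun i) t = tnth t i.
Proof.
rewrite /tdot (bigD1 i)//= /basisfun eqxx mul1r big1 ?addr0// => j /negbTE ->.
by rewrite mul0r.
Qed.

Lemma fdot_basis (u : 'I_n -> R) i : fdot u (basisfun i) = u i.
Proof.
rewrite /fdot (bigD1 i)//= /basisfun eqxx mulr1 big1 ?addr0// => j /negbTE ->.
by rewrite mulr0.
Qed.

Variables (mu lam delta beta : R) (nu : 'cV[R]_n).
Hypotheses (delta_gt0 : 0 < delta) (beta_lt : beta < n%:R + 2).
Local Notation a := ((n%:R + 2 - beta) / 2).
Local Notation z := (- (4^-1 * enorm nu ^+ 2 * delta ^+ 2)).

Let a_gt0 : 0 < a. Proof. by rewrite divr_gt0 ?subr_gt0. Qed.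

Let aE : n%:R / 2 + (1 - beta / 2) = a. Proof. by field. Qed.

Let scale_neq0 : (delta ^+ 2) `^ a * radmom n (1 - beta / 2) != 0.
Proof.
by rewrite mulf_neq0// gt_eqF// ?powR_gt0 ?exprn_gt0// radmom_gt0// aE.
Qed.

Lemma peri_MbE : peri_Mb mu delta beta nu =
  (- (mu * enorm nu ^+ 2 * hypsum (hcoef2 n a) z))%:M -
  (mu * (3 * hypsum (hcoef3 n a) z - hypsum (hcoef2 n a) z)) *: outer nu nu.
Proof.
have d2 : 0 < delta ^+ 2 by rewrite exprn_gt0.
pose p := - (beta / 2) - 1.
have ap : n%:R / 2 + p + 2 = a by rewrite /p; field.
apply/matrixP => i j; rewrite !mxE int_ballE//; last first.
  by rewrite /outer mxE big_ord1 !mxE mul0r mul0r mul0r.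
rewrite (_ : \int[_]_(t in _) _ = \int[lebn]_(t in pball (delta ^+ 2))
    (tdot (basisfun i) t * tdot (basisfun j) t * tsq t `^ p *
     (cos (tdot (cvfun nu) t) - 1))); last first.
  apply: eq_Rintegral => t _.
  rewrite dotv_colt !tdot_basis /outer !mxE big_ord1 !mxE enorm_powR -powRN.
  by congr (_ * _ `^ _ * _); rewrite /p; field.
have := @cosine_bilinear_integral _ (cvfun nu) d2 (basisfun i) (basisfun j) p.
rewrite /= ap => ->//; rewrite !fdot_basis peri_cE ?aE// /cosint_scale ap.
(* The radial integral is now the one in [peri_c], so the two cancel below. *)
have -> : p + 2 = 1 - beta / 2 by rewrite /p; ring.
rewrite enorm_sq big_ord1 !mxE.
have -> : basisfun i j = (i == j)%:R by rewrite /basisfun eq_sym.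
move: scale_neq0; move: (_ `^ a) (radmom _ _) (hypsum _ _) (hypsum _ _) => x y h2 h3.
rewrite mulf_eq0 negb_or => /andP[x0 y0].
have N0 : n%:R != 0 :> R by rewrite pnatr_eq0.
have N2 : n%:R + 2 != 0 :> R by rewrite gt_eqF// ltr_wpDl.
rewrite -/(cvfun nu i) -/(cvfun nu j) -mulr_natr.
move: N0 N2; move: (n%:R : R) => N N0 N2.
by field; rewrite x0 y0 N0 N2.
Qed.

Lemma peri_MsE : peri_Ms mu lam delta beta nu =
  (- (lam - mu) * hypsum (hcoef1 n a) z ^+ 2) *: outer nu nu.
Proof.
have d2 : 0 < delta ^+ 2 by rewrite exprn_gt0.
pose p := - (beta / 2).
have ap : n%:R / 2 + p + 1 = a by rewrite /p; field.
have N0 : n%:R != 0 :> R by rewrite pnatr_eq0.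
(* The factor 2 / c, squared in the outer product, is what c^2 / 4 in the definition of M_s
   cancels. *)
have sE : peri_sin delta beta nu =
   (2 / peri_c n delta beta * hypsum (hcoef1 n a) z) *: nu.
  apply/matrixP => i j; rewrite !mxE (ord1 j) int_ballE//; last by rewrite !mxE !mul0r.
  rewrite (_ : \int[_]_(t in _) _ = \int[lebn]_(t in pball (delta ^+ 2))
    (tdot (basisfun i) t * tsq t `^ p * sin (tdot (cvfun nu) t))); last first.
    apply: eq_Rintegral => t _.
    by rewrite dotv_colt !tdot_basis !mxE enorm_powR -powRN.
  rewrite sine_integral ?ap// !fdot_basis peri_cE ?aE// enorm_sq.
  have -> : p + 1 = 1 - beta / 2 by rewrite /p; ring.
  move: scale_neq0; move: (_ `^ a) (radmom _ _) (hypsum _ _) => x y h1.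
  rewrite mulf_eq0 negb_or => /andP[x0 y0]; rewrite -/(cvfun nu i).
  move: N0; move: (n%:R : R) => N N0.
  by field; rewrite x0 y0 N0.
have c0 : peri_c n delta beta != 0.
  by rewrite peri_cE ?aE// mulf_neq0 ?invr_eq0// mulf_neq0.
apply/matrixP => i j; rewrite /peri_Ms sE /outer !mxE !big_ord1 !mxE.
by field.
Qed.

End multiplier.

(** * Eigenpairs and local limits *)

Section eigenvalues.
Variables (R : realType) (n' : nat).
Local Notation n := n'.+1.
Implicit Types (mu lam delta beta z : R) (nu v : 'cV[R]_n).
Local Notation a beta := ((n%:R + 2 - beta) / 2).
Local Notation z nu delta := (- (4^-1 * enorm nu ^+ 2 * delta ^+ 2)).

Let n2E : (n%:R + 2) / 2 = n%:R / 2 + 1 :> R. Proof. by field. Qed.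
Let n4E : (n%:R + 4) / 2 = n%:R / 2 + 2 :> R. Proof. by field. Qed.
Let a1E beta : (n%:R + 4 - beta) / 2 = a beta + 1. Proof. by field. Qed.

Lemma peri_lambda1E mu lam delta beta nu : peri_lambda1 mu lam delta beta nu =
  - enorm nu ^+ 2 * (3 * mu * hypsum (hcoef3 n (a beta)) (z nu delta) +
    (lam - mu) * hypsum (hcoef1 n (a beta)) (z nu delta) ^+ 2).
Proof.
rewrite /peri_lambda1/=; congr (_ * (_ * _ + _ * _ ^+ 2));
  rewrite /hypergeom /hypsum; congr (limn (series _)); apply/funext => j;
  by rewrite /hypterm /hcoef1 /hcoef3 !big_cons !big_nil !mulr1 ?n2E ?n4E a1E.
Qed.

Lemma peri_lambda2E mu delta beta nu : peri_lambda2 mu delta beta nu =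
  - mu * enorm nu ^+ 2 * hypsum (hcoef2 n (a beta)) (z nu delta).
Proof.
rewrite /peri_lambda2/=; congr (_ * _);
  rewrite /hypergeom /hypsum; congr (limn (series _)); apply/funext => j;
  by rewrite /hypterm /hcoef2 !big_cons !big_nil !mulr1 n4E a1E.
Qed.

Lemma outer_mulmx nu v : outer nu nu *m v = dotv nu v *: nu.
Proof.
apply/matrixP => i j; rewrite !mxE (ord1 j) /dotv mulr_suml.
by apply: eq_bigr => l _; rewrite /outer !mxE big_ord1 !mxE; ring.
Qed.

Lemma dotv_self nu : dotv nu nu = enorm nu ^+ 2.
Proof.
rewrite /enorm sqr_sqrtr// /dotv; apply: sumr_ge0 => i _.
by rewrite -expr2 sqr_ge0.
Qed.

Lemma isotropic_mulmx (x y : R) nu v :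
  (x%:M + y *: outer nu nu) *m v = x *: v + (y * dotv nu v) *: nu.
Proof. by rewrite mulmxDl mul_scalar_mx -scalemxAl outer_mulmx scalerA. Qed.

Lemma peri_ME mu lam delta beta nu : 0 < delta -> beta < n%:R + 2 ->
  peri_M mu lam delta beta nu =
  (- mu * enorm nu ^+ 2 * hypsum (hcoef2 n (a beta)) (z nu delta))%:M +
  (- (mu * (3 * hypsum (hcoef3 n (a beta)) (z nu delta) -
            hypsum (hcoef2 n (a beta)) (z nu delta))) -
   (lam - mu) * hypsum (hcoef1 n (a beta)) (z nu delta) ^+ 2) *: outer nu nu.
Proof.
move=> d0 bn; rewrite /peri_M peri_MbE// peri_MsE// !mulNr scalerBl !scaleNr.
by rewrite [RHS]addrA.
Qed.

Lemma navier_ME mu lam nu : navier_M mu lam nu =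
  (- mu * enorm nu ^+ 2)%:M + (- (lam + mu)) *: outer nu nu.
Proof. by rewrite /navier_M addrC mulNr raddfN. Qed.

Lemma peri_eigenpairs mu lam delta beta nu : 0 < delta -> beta < n%:R + 2 ->
  nu != 0 ->
  [/\ eigenpair (peri_M mu lam delta beta nu)
        (peri_lambda1 mu lam delta beta nu) nu,
      eigenpair (navier_M mu lam nu) (- (lam + 2 * mu) * enorm nu ^+ 2) nu &
      forall v, v != 0 -> dotv nu v = 0 ->
        eigenpair (peri_M mu lam delta beta nu)
          (peri_lambda2 mu delta beta nu) v /\
        eigenpair (navier_M mu lam nu) (- mu * enorm nu ^+ 2) v].
Proof.
move=> d0 bn nu0.
split=> [||v v0 nv]; last split; split=> //;
  rewrite ?peri_ME ?navier_ME// isotropic_mulmx ?dotv_self ?nv ?mulr0 ?scale0r ?addr0.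
(* Along [nu] the scalar part and the rank-one part add up, and the two contributions of the 2F3
   cancel. *)
- by rewrite -scalerDl peri_lambda1E; congr (_ *: _); ring.
- by rewrite -scalerDl; congr (_ *: _); ring.
- by rewrite peri_lambda2E.
- by [].
Qed.

Lemma cvg_of_dist1 (T : Type) (F : set_system T) (FF : ProperFilter F) (H g : T -> R) :
  (\forall x \near F, `|H x - 1| <= g x) -> g @ F --> (0 : R) -> H @ F --> (1 : R).
Proof.
move=> Hg g0; suff : (fun x => H x - 1) @ F --> (0 : R).
  by move=> /subr_cvg0.
apply: norm_cvg0; apply: (squeeze_cvgr _ (cvg_cst 0) g0).
by near=> x; rewrite normr_ge0/=; near: x.
Unshelve. all: by end_near.
Qed.

Let hyp_dist1 (c : nat -> R) beta (y : R) : c 0%N = 1 ->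
  (forall j, 0 <= c j.+1 <= Num.min 1 (a beta)) ->
  `|hypsum c y - 1| <= Num.min 1 (a beta) * (expR `|y| - 1).
Proof. exact: hypergeom_dist1. Qed.

Let a_ge0 beta : beta <= n%:R + 2 -> 0 <= a beta.
Proof. by move=> bn; rewrite divr_ge0 ?subr_ge0. Qed.

(** Both parameters vary along an arbitrary filter, so that the two local limits are instances; each
    only has to make one factor of the distance bound tend to 0. *)
Let eigenvalue_cvg (T : Type) (F : set_system T) (FF : ProperFilter F)
    (delta beta : T -> R) mu lam nu :
  (\forall x \near F, beta x <= n%:R + 2) ->
  Num.min 1 (a (beta x)) * (expR `|z nu (delta x)| - 1) @[x --> F] --> (0 : R) ->
  (peri_lambda1 mu lam (delta x) (beta x) nu @[x --> F]
     --> - (lam + 2 * mu) * enorm nu ^+ 2) /\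
  (peri_lambda2 mu (delta x) (beta x) nu @[x --> F] --> - mu * enorm nu ^+ 2).
Proof.
move=> bn g0.
have H1 : hypsum (hcoef1 n (a (beta x))) (z nu (delta x)) @[x --> F] --> (1 : R).
  apply: cvg_of_dist1 g0; near=> x; have bx : beta x <= n%:R + 2 by near: x.
  by apply: hyp_dist1; [exact: hcoef1_0|move=> j; apply: hcoef1_le; exact: a_ge0].
have H2 : hypsum (hcoef2 n (a (beta x))) (z nu (delta x)) @[x --> F] --> (1 : R).
  apply: cvg_of_dist1 g0; near=> x; have bx : beta x <= n%:R + 2 by near: x.
  by apply: hyp_dist1; [exact: hcoef2_0|move=> j; apply: hcoef2_le; exact: a_ge0].
have H3 : hypsum (hcoef3 n (a (beta x))) (z nu (delta x)) @[x --> F] --> (1 : R).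
  apply: cvg_of_dist1 g0; near=> x; have bx : beta x <= n%:R + 2 by near: x.
  by apply: hyp_dist1; [exact: hcoef3_0|move=> j; apply: hcoef3_le => //; exact: a_ge0].
split.
- under eq_cvg do rewrite peri_lambda1E.
  (* With every series replaced by 1, the bracket is 3 mu + (lam - mu) = lam + 2 mu. *)
  rewrite (_ : _ * _ = - enorm nu ^+ 2 * (3 * mu * 1 + (lam - mu) * 1 ^+ 2)); last by ring.
  apply: cvgMr; apply: cvgD; first exact: cvgMr.
  by apply: cvgMr; under eq_cvg do rewrite expr2; rewrite expr2; exact: cvgM.
- rewrite -[X in _ --> X]mulr1; under eq_cvg do rewrite peri_lambda2E.
  exact: cvgMr.
Unshelve. all: by end_near.
Qed.

Lemma peri_lambda_cvg_delta mu lam beta nu : beta <= n%:R + 2 ->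
  (peri_lambda1 mu lam delta beta nu @[delta --> 0^'+]
     --> - (lam + 2 * mu) * enorm nu ^+ 2) /\
  (peri_lambda2 mu delta beta nu @[delta --> 0^'+] --> - mu * enorm nu ^+ 2).
Proof.
move=> bn; apply: (@eigenvalue_cvg _ _ _ id (fun=> beta)); first exact: nearW.
rewrite -[X in _ --> X](mulr0 (Num.min 1 (a beta))); apply: cvgMr.
apply: cvg_at_right_filter.
have c1 : `|z nu delta| @[delta --> (0 : R)] --> (0 : R).
  have n0 : `|0 : R| = 0 by rewrite normr0.
  rewrite -[X in _ --> X]n0; apply: cvg_norm.
  rewrite -[X in _ --> X]oppr0; apply: cvgN.
  rewrite -[X in _ --> X](mulr0 (4^-1 * enorm nu ^+ 2)); apply: cvgMr.
  rewrite -[X in _ --> X](mulr0 0); under eq_cvg do rewrite expr2.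
  by apply: cvgM; exact: cvg_id.
have c2 : expR x @[x --> (0 : R)] --> (1 : R).
  by rewrite -[X in _ --> X](@expR0 R); exact: continuous_expR.
rewrite -[X in _ --> X](subrr 1); apply: cvgB; last exact: cvg_cst.
exact: (cvg_comp _ _ c1 c2).
Qed.

Lemma peri_lambda_cvg_beta mu lam delta nu :
  (peri_lambda1 mu lam delta beta nu @[beta --> (n%:R + 2)^'-]
     --> - (lam + 2 * mu) * enorm nu ^+ 2) /\
  (peri_lambda2 mu delta beta nu @[beta --> (n%:R + 2)^'-]
     --> - mu * enorm nu ^+ 2).
Proof.
have near_le : \forall beta \near (n%:R + 2 : R)^'-, beta <= n%:R + 2.
  by near=> b; apply: ltW; near: b; exact: nbhs_left_lt.
apply: (@eigenvalue_cvg _ _ _ (fun=> delta) id) => //.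
rewrite -[X in _ --> X](mul0r (expR `|z nu delta| - 1)); apply: cvgMl.
have c1 : a beta @[beta --> (n%:R + 2)^'-] --> (0 : R).
  apply: cvg_at_left_filter.
  rewrite -[X in _ --> X](mul0r 2^-1); apply: cvgMl.
  rewrite -[X in _ --> X](subrr (n%:R + 2)); apply: cvgB; first exact: cvg_cst.
  exact: cvg_id.
(* Min(1, a) is squeezed between 0 and a; nonnegativity of a is where approaching from the left is
   used. *)
apply: (squeeze_cvgr _ (cvg_cst 0) c1); near=> b.
have bn : b <= n%:R + 2 by near: b; exact: near_le.
by rewrite le_min ler01 a_ge0//= ge_min lexx orbT.
Unshelve. all: by end_near.
Qed.

End eigenvalues.

Theorem corollary1 (R : realType) (n : nat) (mu lam : R) (nu : 'cV[R]_n)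
    (n_ge1 : (1 <= n)%N) (nu_neq0 : nu != 0) :
  (forall delta beta : R, 0 < delta -> beta < n%:R + 2 ->
    [/\ eigenpair (peri_M mu lam delta beta nu)
          (peri_lambda1 mu lam delta beta nu) nu,
        eigenpair (navier_M mu lam nu) (- (lam + 2 * mu) * enorm nu ^+ 2) nu &
        forall v : 'cV[R]_n, v != 0 -> dotv nu v = 0 ->
          eigenpair (peri_M mu lam delta beta nu)
            (peri_lambda2 mu delta beta nu) v /\
          eigenpair (navier_M mu lam nu) (- mu * enorm nu ^+ 2) v]) /\
  (forall beta : R, beta <= n%:R + 2 ->
    (peri_lambda1 mu lam delta beta nu @[delta --> 0^'+]
       --> - (lam + 2 * mu) * enorm nu ^+ 2) /\
    (peri_lambda2 mu delta beta nu @[delta --> 0^'+]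
       --> - mu * enorm nu ^+ 2)) /\
  (forall delta : R, 0 < delta ->
    (peri_lambda1 mu lam delta beta nu @[beta --> (n%:R + 2)^'-]
       --> - (lam + 2 * mu) * enorm nu ^+ 2) /\
    (peri_lambda2 mu delta beta nu @[beta --> (n%:R + 2)^'-]
       --> - mu * enorm nu ^+ 2)).
Proof.
case: n n_ge1 nu nu_neq0 => [//|n] _ nu nu_neq0; split; last split.
- by move=> delta beta d0 bn; exact: peri_eigenpairs.
- by move=> beta bn; exact: peri_lambda_cvg_delta.
- by move=> delta _; exact: peri_lambda_cvg_beta.
Qed.
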